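(* Let $m\ge1$ be an integer and assume the function $f_m$ described in the context exists. Let $p,q,r$ be positive integers and $k_1,\ldots,k_r$ integers $\ge2$; put $K_j=k_r+k_{r-1}+\cdots+k_{r+1-j}$ for $0\le j\le r$ ($K_0=0$). Then \[ \psi^{(m)}(\{1\}_{q-1},k_1,\ldots,k_{r-1},k_r-1;p+1)-(-1)^{k_1+\cdots+k_r}\psi^{(m)}(\{1\}_{p-1},k_r,\ldots,k_2,k_1-1;q+1) \] \[ =\sum_{j=0}^{r-1}(-1)^{K_j}\sum_{i=1}^{k_{r-j}-2}(-1)^{i-1}T^{(m)}(\{1\}_{p-1},k_r,\ldots,k_{r+1-j},i+1)\,T^{(m)}(\{1\}_{q-1},k_1,\ldots,k_{r-j-1},k_{r-j}-i) \] \[ +\sum_{j=0}^{r-2}(-1)^{K_{j+1}}\lim_{x\to1^-}\Big\{{\rm A}^{(m)}(\mathbf{a}_j;x){\rm A}^{(m)}(\mathbf{b}_j,1;x)-{\rm A}^{(m)}(\mathbf{a}_j,1;x){\rm A}^{(m)}(\mathbf{b}_j;x)\Big\}, \] where $\mathbf{a}_j=(\{1\}_{p-1},k_r,\ldots,k_{r-j})$, $\mathbf{b}_j=(\{1\}_{q-1},k_1,\ldots,k_{r-j-1})$, and sequences such as $k_r,\ldots,k_{r+1-j}$ (for $j=0$) or $k_1,\ldots,k_{r-j-1}$ (for $j=r-1$) are empty.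
   Context: Fix an integer $m\ge1$. Assume there is a differentiable function $f_m:[0,\infty)\to\mathbb{R}$ satisfying $f_m'(z)+f_m(z)^m=1$, $\frac{d}{dz}\log f_m(z)=\frac{m^2e^{-mz}}{1-e^{-m^2z}}$ for $z>0$, $f_m(0)=0$ and $f_m(z)\to1$ as $z\to+\infty$. ${\rm Ath}^{(m)}(k_1,\ldots,k_r;z)=\sum_{1\le n_1<\cdots<n_r,\ n_i\equiv i\pmod m}\frac{z^{n_r}}{n_1^{k_1}\cdots n_r^{k_r}}$ for $z\in[-1,1)$, ${\rm A}^{(m)}(k_1,\ldots,k_r;z)=m^r{\rm Ath}^{(m)}(k_1,\ldots,k_r;z)$. $T^{(m)}(k_1,\ldots,k_{r-1},s)=m^r\sum_{1\le n_1<\cdots<n_r,\ n_i\equiv i\pmod m}\frac{1}{n_1^{k_1}\cdots n_{r-1}^{k_{r-1}}n_r^s}$. $\psi^{(m)}(k_1,\ldots,k_r;s)=\frac{1}{\Gamma(s)}\int_0^\infty\frac{t^{s-1}}{e^t-e^{(1-m)t}}{\rm A}^{(m)}(k_1,\ldots,k_r;f_m(t/m))\,dt$. $\{1\}_j$ denotes $j$ repetitions of $1$.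
   Formalization: The kernel of ψ^(m) is taken as m/(e^t − e^{(1−m)t}) instead of 1/(e^t − e^{(1−m)t}); with the printed kernel the identity fails, e.g. for m=2, f=tanh, p=q=r=1, k_1=3, where the left side is T(2)²/2 and the right side is T(2)². *)

(* Defs.v *)
From HB Require Import structures.
From mathcomp Require Import all_boot all_order all_algebra.
From mathcomp Require Import all_classical all_reals all_analysis.

Set Implicit Arguments.
Unset Strict Implicit.
Unset Printing Implicit Defensive.

Import Order.TTheory GRing.Theory Num.Theory.
Import numFieldNormedType.Exports.

Local Open Scope classical_set_scope.
Local Open Scope ring_scope.

(* Derivative relative to [0, +oo[: two-sided at z > 0, one-sided at z = 0. *)
Definition has_deriv_ge0 (R : realType) (f : R -> R) (z l : R) : Prop :=
  (fun w => (f w - f z) / (w - z)) @ within [set w | 0 <= w] z^' --> l.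

(* The requirement on ln \o f forces f to be positive on ]0, +oo[: [ln] is the
   constant 0 on nonpositive reals, and the prescribed derivative is positive. *)
Definition is_fm (R : realType) (m : nat) (f : R -> R) : Prop :=
  [/\ forall z : R, 0 <= z ->
        exists2 l, has_deriv_ge0 f z l & l + f z ^+ m = 1,
      forall z : R, 0 < z ->
        is_derive z (1 : R) (fun w => ln (f w))
          (m%:R ^+ 2 * expR (- (m%:R * z)) / (1 - expR (- (m%:R ^+ 2 * z)))),
      f 0 = 0
    & f z @[z --> +oo] --> (1 : R)].

(* For n = (n_1, ..., n_r): 1 <= n_1 < ... < n_r and n_i = i mod m; the i-th
   entry is [tnth n i] with i counted from 0. *)
Definition admissible (m r N : nat) (n : r.-tuple 'I_N.+1) : bool :=
  path ltn 0%N [seq val i | i <- n] &&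
  [forall i : 'I_r, (tnth n i == i.+1 %[mod m])%N].

(* n_r, with the convention n_0 = 0 for the empty tuple *)
Definition top_index (r N : nat) (n : r.-tuple 'I_N.+1) : nat :=
  last 0%N [seq val i | i <- n].

(* Multiple series are limits, as N grows, of their partial sums over the
   tuples with n_r <= N. *)
Definition Ath (R : realType) (m : nat) (k : seq nat) (z : R) : R :=
  limn (fun N : nat => \sum_(n : (size k).-tuple 'I_N.+1 | admissible m n)
    z ^+ top_index n
      / \prod_(i < size k) (tnth n i)%:R ^+ nth 0%N k i).

Definition A (R : realType) (m : nat) (k : seq nat) (z : R) : R :=
  m%:R ^+ size k * Ath m k z.

(* T m [:: k_1; ...; k_(r-1)] s is T^(m)(k_1, ..., k_(r-1), s). *)
Definition T (R : realType) (m : nat) (k : seq nat) (s : R) : R :=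
  m%:R ^+ (size k).+1 *
  limn (fun N : nat => \sum_(n : (size k).+1.-tuple 'I_N.+1 | admissible m n)
    ((\prod_(i < size k) (tnth n (widen_ord (leqnSn _) i))%:R ^+ nth 0%N k i)
      * (tnth n ord_max)%:R `^ s)^-1).

Definition Gamma (R : realType) (s : R) : R :=
  \int[lebesgue_measure]_(t in `]0, +oo[) (t `^ (s - 1) * expR (- t)).

(* The kernel m / (e^t - e^((1-m)t)) is the logarithmic derivative of
   t |-> f (t / m): it is 1 / (e^t - 1) for m = 1 (Arakawa-Kaneko) and
   1 / sinh t for m = 2 (Kaneko-Tsumura). The source prints 1 instead of m in
   the numerator; this scales psi by 1 / m, and the identities expressing psi
   through T-values then fail at m = 2, where f = tanh. *)
Definition psi (R : realType) (m : nat) (f : R -> R) (k : seq nat) (s : R) : R :=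
  (Gamma s)^-1 *
  \int[lebesgue_measure]_(t in `]0, +oo[)
    (t `^ (s - 1) * (m%:R / (expR t - expR ((1 - m%:R) * t)))
      * A m k (f (t / m%:R))).

(* k_1, ..., k_a *)
Definition kup (k : nat -> nat) (a : nat) : seq nat :=
  [seq k i | i <- iota 1 a].

(* k_r, k_(r-1), ..., k_(r+1-j) *)
Definition kdown (k : nat -> nat) (r j : nat) : seq nat :=
  [seq k (r - i)%N | i <- iota 0 j].

(* Main.v *)
(* With x = f(t/m) the kernel of psi is d(log x)/dt, and A(1,...,1; x) = t^p/p!,
   so psi(k; p+1) is the integral of A(1,...,1; x) A(k; x) dx/x over ]0, 1[
   (p ones).  Write I(a, b) for the integral of A(a; x) A(b; x) dx/x.  As
   d A(a, c+1) = A(a, c) dx/x, integrating by parts moves one unit from the last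
   entry of b to the last entry of a and leaves the product T(a, c+1) T(b, e).
   When the last entry of b has come down to 1, d A(b, 1) = A(b; x) m dx/(1 - x^m)
   is used on both factors: the integrals of A(a; x) A(b; x) m dx/(1 - x^m) cancel
   and the boundary term is the limit in the second sum.  Repeating this for
   k_r, ..., k_1 exchanges the roles of the two index sequences. *)
Require Import Defs.
From mathcomp Require Import all_boot all_order all_algebra.
From mathcomp Require Import all_classical all_reals all_analysis.
From mathcomp Require Import ring lra zify.
Import Order.TTheory GRing.Theory Num.Theory.
Import numFieldNormedType.Exports.
Local Open Scope classical_set_scope.
Local Open Scope ring_scope.

(** The obstacle is the point 1, where A(k; x) may grow like a power of a logarithm: every limit
    must be shown to exist. The integrals I(a, b) are therefore limits of primitives on [0, 1[
    vanishing at 0, which are nondecreasing, and bounded because powers of A(1; x) are integrable up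
    to 1. Integration by parts becomes the equality of two functions with the same derivative and
    the same value at 0; only then does x tend to 1. The order matters when the last entry is 1: the
    integrals of A(a; x) A(b; x) m dx/(1 - x^m) diverge, and cancel only under the derivative. The
    function f occurs only in the passage from psi to I, through A(1; f(t/m)) = t. *)

(** * Multiple sums over admissible tuples *)

(* The factor m^r of A(k; x) is absorbed: for e = nth 0 k and r = size k this is
   the coefficient of x^n in A(k; x), computed by fixing n_r = n. *)
Fixpoint scoef (R : realType) (m : nat) (e : nat -> nat) (r n : nat) : R :=
  if r is r'.+1 then
    m%:R * (\sum_(i < n) scoef R m e r' i) / n%:R ^+ e r'
      *+ (n == r'.+1 %[mod m])%N
  else (n == 0%N)%:R.

Definition acoef (R : realType) (m : nat) (k : seq nat) : nat -> R :=
  scoef R m (nth 0%N k) (size k).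

Lemma eq_scoef (R : realType) m (e1 e2 : nat -> nat) r n :
  (forall i, (i < r)%N -> e1 i = e2 i) ->
  scoef R m e1 r n = scoef R m e2 r n.
Proof.
elim: r n => [//|r IH] n E /=; rewrite E //.
congr (_ * _ / _ *+ _); apply: eq_bigr => i _; apply: IH => j jr.
exact/E/ltnW.
Qed.

Lemma acoef_rcons (R : realType) m k c n :
  acoef R m (rcons k c) n =
  m%:R * (\sum_(i < n) acoef R m k i) / n%:R ^+ c
    *+ (n == (size k).+1 %[mod m])%N.
Proof.
rewrite /acoef size_rcons /= nth_rcons ltnn eqxx.
congr (_ * _ / _ *+ _); apply: eq_bigr => i _; apply: eq_scoef => j jk.
by rewrite nth_rcons jk.
Qed.

Lemma big_tuple_rcons (R : Type) (idx : R) (op : Monoid.com_law idx)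
    (I : finType) r (P : pred (r.+1.-tuple I)) (F : r.+1.-tuple I -> R) :
  \big[op/idx]_(t | P t) F t =
  \big[op/idx]_(x : I) \big[op/idx]_(s : r.-tuple I | P [tuple of rcons s x])
     F [tuple of rcons s x].
Proof.
pose g (p : I * r.-tuple I) : r.+1.-tuple I := [tuple of rcons p.2 p.1].
have gbij : bijective g.
  apply: inj_card_bij; last by rewrite card_prod !card_tuple expnS.
  move=> [x s] [y t] /(congr1 val) /= /rcons_inj [st xy].
  by congr pair; [|exact: val_inj].
rewrite (reindex g) /=; last exact: onW_bij.
by rewrite pair_big_dep.
Qed.

Lemma forall_ord_recr r (P : pred 'I_r.+1) :
  [forall i, P i] = [forall i : 'I_r, P (widen_ord (leqnSn r) i)] && P ord_max.
Proof.
apply/forallP/andP => [H|[/forallP H Hr] i]; first by split; [apply/forallP|].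
have [ir|ri] := ltnP i r; last first.
  by rewrite (_ : i = ord_max) //; apply/val_inj/eqP; rewrite eqn_leq ri -ltnS ltn_ord.
by rewrite (_ : i = widen_ord (leqnSn r) (Ordinal ir)) //; exact: val_inj.
Qed.

(** The weight [h] is free for two reasons: x^n and 1 give the partial sums of A and T, and the
    induction on r uses the indicator of n < x, which turns the condition on the next index x into a
    weight. *)
Lemma sum_admissible (R : realType) m (e : nat -> nat) r N (h : nat -> R) :
  m%:R ^+ r * (\sum_(n : r.-tuple 'I_N.+1 | admissible m n)
     h (top_index n) / \prod_(i < r) (tnth n i)%:R ^+ e i) =
  \sum_(n < N.+1) h n * scoef R m e r n.
Proof.
elim: r h => [|r IH] h.
  rewrite expr0 mul1r (big_pred1 [tuple]) /=; last first.
    by move=> t; rewrite (tuple0 t) [RHS]eqxx; apply/andP; split=> //; apply/forallP; case.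
  rewrite big_ord0 divr1 big_ord_recl big1 /= => [|i _]; last by rewrite mulr0.
  by rewrite mulr1 addr0.
rewrite big_tuple_rcons mulr_sumr; apply: eq_bigr => x _.
have adm (s : r.-tuple 'I_N.+1) : admissible m [tuple of rcons s x] =
    admissible m s && (top_index s < x)%N && (x == r.+1 %[mod m])%N.
  rewrite /admissible /top_index /= map_rcons rcons_path forall_ord_recr.
  rewrite -!andbA; congr andb; rewrite andbCA; congr andb.
    by apply: eq_forallb => i; rewrite !(tnth_nth x) /= nth_rcons size_tuple ltn_ord.
  by rewrite (tnth_nth x) /= nth_rcons size_tuple ltnn eqxx.
under eq_bigl do rewrite adm.
have [xr|xr] := boolP (x == r.+1 %[mod m])%N; last first.
  by rewrite big1 /= ?(negbTE xr) ?mulr0n ?mulr0 // => s; rewrite andbF.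
rewrite /= xr mulr1n.
under eq_bigl do rewrite andbT.
transitivity (m%:R * (h x / x%:R ^+ e r) *
    (m%:R ^+ r * \sum_(s : r.-tuple 'I_N.+1 | admissible m s)
      (top_index s < x)%N%:R / \prod_(i < r) (tnth s i)%:R ^+ e i)).
  rewrite exprS [RHS]mulrACA; congr (_ * _).
  rewrite big_mkcondr /= mulr_sumr; apply: eq_bigr => s _.
  case: ltnP => _; last by rewrite mul0r mulr0.
  rewrite /top_index /= map_rcons last_rcons big_ord_recr /=.
  rewrite invfM (tnth_nth x _ ord_max) /= nth_rcons size_tuple ltnn eqxx mul1r.
  rewrite mulrA mulrAC; congr (_ / _ * _^-1).
  by apply: eq_bigr => i _; rewrite !(tnth_nth x) /= nth_rcons size_tuple ltn_ord.
rewrite (IH (fun n => (n < x)%N%:R)).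
have -> : \sum_(n < N.+1) (n < x)%N%:R * scoef R m e r n =
    \sum_(i < x) scoef R m e r i.
  rewrite (big_ord_widen N.+1 (scoef R m e r)); last exact/ltnW/ltn_ord.
  by rewrite [RHS]big_mkcond; apply: eq_bigr => i _; case: ltnP; rewrite ?mul1r ?mul0r.
by rewrite !mulrA; ring.
Qed.

(** * Power series on the unit disc *)

Lemma is_cvg_pseries_bounded (R : realType) (u : nat -> R) (M x : R) :
  (forall n, `|u n| <= M) -> `|x| < 1 -> cvgn (pseries u x).
Proof.
move=> uM x1; apply: normed_cvg.
have x1' : `| `|x| | < 1 by rewrite normr_id.
apply: series_le_cvg (is_cvg_geometric_series (a := M) x1') => n /=.
- exact: normr_ge0.
- by rewrite mulr_ge0 ?exprn_ge0 // (le_trans _ (uM 0%N)).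
- by rewrite normrM normrX ler_wpM2r // exprn_ge0.
Qed.

(** The quantity (n+1) t^n (1 - t) + t^(n+1) is 1 at n = 0 and drops by (n+1) t^n (1 - t)^2 at each
    step. *)
Lemma mulrn_exp_le (R : realFieldType) (t : R) n :
  0 <= t < 1 -> n.+1%:R * t ^+ n <= (1 - t)^-1.
Proof.
move=> /andP[t0 t1]; rewrite -[leRHS]mul1r ler_pdivlMr ?subr_gt0 //.
suff : n.+1%:R * t ^+ n * (1 - t) + t ^+ n.+1 <= 1.
  by apply: le_trans; rewrite lerDl exprn_ge0.
elim: n => [|n IH]; first by rewrite expr0 expr1; lra.
apply: le_trans IH; rewrite -subr_ge0.
have -> : n.+1%:R * t ^+ n * (1 - t) + t ^+ n.+1
   - (n.+2%:R * t ^+ n.+1 * (1 - t) + t ^+ n.+2) =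
   n.+1%:R * t ^+ n * (1 - t) ^+ 2 by rewrite -(natr1 n.+1) !exprS; ring.
by rewrite !mulr_ge0 ?exprn_ge0 ?subr_ge0 // ltW.
Qed.

Lemma is_cvg_seriesS (R : realType) (u : nat -> R) :
  cvgn (series u) -> cvgn (series (fun n => u n.+1)).
Proof.
move=> /cvg_ex[l ul]; apply/cvg_ex; exists (l - u 0%N).
have -> : series (fun n => u n.+1) = (fun n => series u n.+1 - u 0%N).
  by apply/funext => n; rewrite /series /= big_nat_recl // addrAC subrr add0r.
by apply: cvgB; [rewrite -cvg_shiftS in ul|exact: cvg_cst].
Qed.
Arguments is_cvg_seriesS {R u}.

Lemma is_cvg_pseries_diffs (R : realType) (u : nat -> R) :
  (forall x, `|x| < 1 -> cvgn (pseries u x)) ->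
  forall x, `|x| < 1 -> cvgn (pseries (pseries_diffs u) x).
Proof.
move=> cu x x1; apply: normed_cvg.
(* Convergence at s gives absolute convergence at r < s; the gap between |x| and r absorbs the
   factor n + 1, by [mulrn_exp_le] at |x| / r. *)
pose r := (1 + `|x|) / 2; pose s := (1 + r) / 2.
have x0 := normr_ge0 x.
have r0 : 0 < r by rewrite /r; lra.
have xr : `|x| < r by rewrite /r; lra.
have r1 : r < 1 by rewrite /r; lra.
have rs : r < s by rewrite /s; lra.
have s1 : s < 1 by rewrite /s; lra.
clearbody s r.
have cr : cvgn (pseries (fun i => `|u i|) r).
  apply: (@is_cvg_pseries_inside_norm _ u s); first by apply: cu; rewrite gtr0_norm //; lra.
  by rewrite !gtr0_norm //; lra.
have {}cr : cvgn (series (fun n => (1 - `|x| / r)^-1 / r * (`|u n.+1| * r ^+ n.+1))).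
  apply: is_cvg_seriesZ.
  exact: (is_cvg_seriesS cr).
apply: series_le_cvg cr => n /=.
- exact: normr_ge0.
- by rewrite !mulr_ge0 ?invr_ge0 ?exprn_ge0 ?subr_ge0 ?ler_pdivrMr ?mul1r // ltW.
rewrite /pseries_diffs !normrM normrX ger0_norm //.
have := @mulrn_exp_le _ (`|x| / r) n.
rewrite divr_ge0 ?(ltW r0) //= ltr_pdivrMr // mul1r => /(_ xr) H.
have -> : n.+1%:R * `|u n.+1| * `|x| ^+ n =
  `|u n.+1| * r ^+ n * (n.+1%:R * (`|x| / r) ^+ n).
  rewrite expr_div_n; field; exact/expf_neq0/lt0r_neq0.
have -> : (1 - `|x| / r)^-1 / r * (`|u n.+1| * r ^+ n.+1) =
   `|u n.+1| * r ^+ n * (1 - `|x| / r)^-1.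
  rewrite exprS; field.
  by rewrite !lt0r_neq0 ?subr_gt0.
by rewrite ler_wpM2l // mulr_ge0 // exprn_ge0 // ltW.
Qed.

Lemma is_derive_pseries (R : realType) (u : nat -> R) (x : R) :
  (forall y, `|y| < 1 -> cvgn (pseries u y)) -> `|x| < 1 ->
  is_derive x (1 : R) (fun y => limn (pseries u y))
    (limn (pseries (pseries_diffs u) x)).
Proof.
move=> cu x1; pose K := (1 + `|x|) / 2; have x0 := normr_ge0 x.
have K1 : `|K| < 1 by rewrite gtr0_norm /K; lra.
have cd := is_cvg_pseries_diffs _ _ cu; have cdd := is_cvg_pseries_diffs _ _ cd.
apply: (@pseries_snd_diffs _ _ K); [exact: cu|exact: cd|exact: cdd|].
by rewrite [ltRHS]gtr0_norm /K; lra.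
Qed.

Lemma limn_pseriesS (R : realType) (u : nat -> R) (x : R) :
  cvgn (pseries (fun n => u n.+1) x) ->
  limn (pseries u x) = u 0%N + x * limn (pseries (fun n => u n.+1) x).
Proof.
move=> cu; apply/cvg_lim => //; rewrite -cvg_shiftS.
have -> : [sequence pseries u x n.+1]_n =
    (fun n => u 0%N + x * pseries (fun n => u n.+1) x n).
  apply/funext => n; rewrite /pseries /series /= big_nat_recl //= expr0 mulr1.
  congr (_ + _); rewrite mulr_sumr; apply: eq_bigr => i _.
  by rewrite exprS; ring.
by apply: cvgD; [exact: cvg_cst|apply: cvgZr].
Qed.

(** * The functions A(k; x) *)

Section Coef.
Variables (R : realType) (m : nat).
Hypothesis hm : (1 <= m)%N.
Implicit Types (k : seq nat) (n c : nat).
Local Notation a := (acoef R m).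

Lemma acoef_nil n : a [::] n = (n == 0%N)%:R.
Proof. by []. Qed.

Lemma acoef_ge0 k n : 0 <= a k n.
Proof.
elim/last_ind: k n => [|k c IH] n; first by rewrite acoef_nil; case: eqP.
by rewrite acoef_rcons mulrn_wge0 // divr_ge0 ?exprn_ge0 // mulr_ge0 // sumr_ge0.
Qed.

(** Dividing by n^c with c >= 1 compensates for the n terms of the sum, so each entry costs one
    factor m. *)
Lemma acoef_le k n : all (leq 1) k -> a k n <= m%:R ^+ size k.
Proof.
elim/last_ind: k n => [|k c IH] n.
  by rewrite acoef_nil expr0; case: eqP.
rewrite all_rcons => /andP[c0 k0]; rewrite acoef_rcons size_rcons.
case: (_ == _ %[mod m])%N; rewrite ?mulr1n ?mulr0n ?exprn_ge0 //.
case: n => [|n]; first by rewrite big_ord0 mulr0 mul0r exprn_ge0.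
rewrite exprS -mulrA ler_wpM2l // ler_pdivrMr ?exprn_gt0 //.
apply: (@le_trans _ _ (m%:R ^+ size k * n.+1%:R)); last first.
  rewrite ler_wpM2l ?exprn_ge0 // -{1}[n.+1%:R]expr1 ler_weXn2l //.
  by rewrite ler1n.
apply: (le_trans (ler_sum _ (fun (i : 'I_n.+1) _ => IH i k0))).
by rewrite sumr_const card_ord mulr_natr.
Qed.

Lemma acoef0 k : k != [::] -> a k 0 = 0.
Proof.
case/lastP: k => [//|k c] _; rewrite acoef_rcons big_ord0 mulr0 mul0r.
by rewrite mul0rn.
Qed.

Lemma acoef_eq0 k n : (n != size k %[mod m])%N -> a k n = 0.
Proof.
case/lastP: k => [|k c]; first by rewrite acoef_nil; case: n => //=; rewrite eqxx.
by rewrite size_rcons acoef_rcons => /negbTE ->.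
Qed.

(** The coefficient form of x d/dx A(k, c+1; x) = A(k, c; x). At n = 0 both sides vanish because the
    inner sum is empty. The case c = 0 serves to differentiate A(k, 1; x). *)
Lemma acoef_rconsS k c n :
  a (rcons k c) n = n%:R * a (rcons k c.+1) n.
Proof.
rewrite !acoef_rcons; case: (_ == _ %[mod m])%N; rewrite ?mulr0n ?mulr0 //.
rewrite !mulr1n; case: n => [|n]; first by rewrite big_ord0 !(mulr0, mul0r).
have n0 : n.+1%:R != 0 :> R by [].
by rewrite exprS invfM [RHS]mulrC [n.+1%:R^-1 * _]mulrC mulrA divfK.
Qed.

Lemma is_cvg_acoef k x : all (leq 1) k -> `|x| < 1 -> cvgn (pseries (a k) x).
Proof.
move=> k0; apply: (is_cvg_pseries_bounded _ _ (m%:R ^+ size k)) => n.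
by rewrite ger0_norm ?acoef_ge0 // acoef_le.
Qed.

Lemma is_cvg_acoefS k x : all (leq 1) k -> `|x| < 1 ->
  cvgn (pseries (fun n => a k n.+1) x).
Proof.
move=> k0; apply: (is_cvg_pseries_bounded _ _ (m%:R ^+ size k)) => n.
by rewrite ger0_norm ?acoef_ge0 // acoef_le.
Qed.

Definition Aser k (x : R) := limn (pseries (a k) x).
(* A(k; x) / x for nonempty k, without the singularity at 0 *)
Definition Bser k (x : R) := limn (pseries (fun n => a k n.+1) x).

Lemma Aser_Bser k x : k != [::] -> all (leq 1) k -> `|x| < 1 ->
  Aser k x = x * Bser k x.
Proof.
move=> kn k0 x1.
by rewrite /Aser limn_pseriesS ?acoef0 ?add0r //; exact: is_cvg_acoefS.
Qed.

Lemma Aser0 k : k != [::] -> all (leq 1) k -> Aser k 0 = 0.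
Proof. by move=> kn k0; rewrite Aser_Bser ?mul0r // normr0. Qed.

Lemma Aser_nil x : Aser [::] x = 1.
Proof.
apply/cvg_lim => //; rewrite -cvg_shiftS.
have -> : [sequence pseries (a [::]) x n.+1]_n = fun=> 1.
  apply/funext => n; rewrite /pseries /series /= big_nat_recl // expr0 mulr1.
  by rewrite big1 ?addr0 // => i _; rewrite acoef_nil mul0r.
exact: cvg_cst.
Qed.

Lemma A_Aser k x : all (leq 1) k -> `|x| < 1 -> A m k x = Aser k x.
Proof.
move=> k0 x1; have mk : m%:R ^+ size k != 0 :> R.
  by rewrite expf_neq0 // pnatr_eq0 -lt0n.
rewrite /A /Ath; set u := (X in limn X).
suff : u @ \oo --> (m%:R ^+ size k)^-1 * Aser k x.
  by move=> /cvg_lim -> //; rewrite mulrA divff // mul1r.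
have -> : u = (fun N => (m%:R ^+ size k)^-1 * pseries (a k) x N.+1).
  apply/funext => N; rewrite /u /pseries /series /= big_mkord.
  under [in RHS]eq_bigr do rewrite mulrC.
  rewrite -(@sum_admissible R m (nth 0%N k) (size k) N (fun n => x ^+ n)).
  by rewrite mulrA mulVf // mul1r.
apply: cvgMl_tmp; have := is_cvg_acoef _ _ k0 x1; rewrite -cvg_shiftS; exact.
Qed.

Lemma T_series k c : cvgn (series (a (rcons k c))) ->
  T m k (c%:R : R) = limn (series (a (rcons k c))).
Proof.
move=> cv; have mk : m%:R ^+ (size k).+1 != 0 :> R.
  by rewrite expf_neq0 // pnatr_eq0 -lt0n.
rewrite /T; set u := (X in limn X).
suff : u @ \oo --> (m%:R ^+ (size k).+1)^-1 * limn (series (a (rcons k c))).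
  by move=> /cvg_lim -> //; rewrite mulrA divff // mul1r.
have -> : u = (fun N => (m%:R ^+ (size k).+1)^-1 * series (a (rcons k c)) N.+1).
  apply/funext => N; rewrite /u /series /= big_mkord.
  have -> : \sum_(i < N.+1) a (rcons k c) i =
      \sum_(i < N.+1) 1 * scoef R m (nth 0%N (rcons k c)) (size k).+1 i.
    by apply: eq_bigr => i _; rewrite mul1r /acoef size_rcons.
  rewrite -(@sum_admissible R m _ _ N (fun=> 1)).
  rewrite mulrA mulVf // mul1r.
  apply: eq_bigr => t _; rewrite mul1r; congr (_^-1).
  rewrite big_ord_recr /= nth_rcons ltnn eqxx powR_mulrn // ; congr (_ * _).
  by apply: eq_bigr => i _; rewrite nth_rcons ltn_ord.
by apply: cvgMl_tmp; move: cv; rewrite -cvg_shiftS; exact.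
Qed.

Lemma is_derive_Aser k x : all (leq 1) k -> `|x| < 1 ->
  is_derive x (1 : R) (Aser k) (limn (pseries (pseries_diffs (a k)) x)).
Proof. by move=> k0 x1; apply: is_derive_pseries => // y; exact: is_cvg_acoef. Qed.

Lemma is_derive_Aser_rconsS k c x :
  all (leq 1) k -> (1 <= c)%N -> `|x| < 1 ->
  is_derive x (1 : R) (Aser (rcons k c.+1)) (Bser (rcons k c) x).
Proof.
move=> k0 c0 x1; have := @is_derive_Aser (rcons k c.+1) x.
rewrite all_rcons k0 => /(_ isT x1).
congr is_derive; rewrite /Bser; congr (limn (pseries _ _)).
by apply/funext => n; rewrite /pseries_diffs [RHS]acoef_rconsS.
Qed.

Lemma pseries_diffs_rcons1 k n :
  pseries_diffs (a (rcons k 1%N)) n =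
  m%:R * (\sum_(i < n.+1) a k i) *+ (n == size k %[mod m])%N.
Proof.
rewrite /pseries_diffs -acoef_rconsS acoef_rcons expr0 divr1; congr (_ *+ _).
by rewrite -[n.+1]addn1 -[(size k).+1]addn1 eqn_modDr.
Qed.

(** Two distinct indices below m are never congruent, so at most the last term of the sum
    survives. *)
Lemma pseries_diffs_rcons1_lt k n : (n < m)%N ->
  pseries_diffs (a (rcons k 1%N)) n = m%:R * a k n.
Proof.
move=> nm; rewrite pseries_diffs_rcons1.
have [nk|nk] := boolP (n == size k %[mod m])%N; last first.
  by rewrite mulr0n acoef_eq0 // mulr0.
rewrite mulr1n big_ord_recr /= big1 ?add0r // => i _.
apply: acoef_eq0; rewrite -(eqP nk) !modn_small //.
  by rewrite neq_ltn ltn_ord.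
exact: ltn_trans (ltn_ord i) nm.
Qed.

(* Summed against x^(n + m), this recurrence is (1 - x^m) A(k, 1)' = m A(k). *)
Lemma pseries_diffs_rcons1D k n :
  pseries_diffs (a (rcons k 1%N)) (n + m) =
  pseries_diffs (a (rcons k 1%N)) n + m%:R * a k (n + m).
Proof.
rewrite !pseries_diffs_rcons1 modnDr.
have [nk|nk] := boolP (n == size k %[mod m])%N; last first.
  by rewrite !mulr0n add0r acoef_eq0 ?mulr0 // modnDr.
rewrite !mulr1n -mulrDr; congr (_ * _).
rewrite big_ord_recr /=; congr (_ + _).
(* The indices strictly between n and n + m are not congruent to [size k], so their coefficients
   vanish. *)
rewrite -(big_mkord xpredT (a k)) (big_cat_nat _ _ (n := n.+1)) //=; last first.
  by lia.
rewrite big_mkord [X in _ + X]big_nat [X in _ + X]big1 ?addr0 // => i ni.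
apply: acoef_eq0; rewrite -(eqP nk).
have -> : (i = n + (i - n))%N by lia.
rewrite -[X in (_ != X %[mod m])%N]addn0 eqn_modDl mod0n modn_small; lia.
Qed.

Lemma is_derive_Aser_rcons1 k x : all (leq 1) k -> `|x| < 1 ->
  is_derive x (1 : R) (Aser (rcons k 1%N)) (Aser k x * (m%:R / (1 - x ^+ m))).
Proof.
move=> k0 x1; have k01 : all (leq 1) (rcons k 1%N) by rewrite all_rcons k0.
have := @is_derive_Aser _ x k01 x1; congr is_derive.
set d := pseries_diffs _.
have cd : cvgn (pseries d x).
  by apply: is_cvg_pseries_diffs => // y; exact: is_cvg_acoef.
have ca := is_cvg_acoef _ _ k0 x1.
have x1' : `|x ^+ m| < 1.
  by rewrite normrX exprn_ilt1 // -lt0n.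
have x1n : 1 - x ^+ m != 0.
  by rewrite subr_eq0; apply: contraTneq x1' => <-; rewrite normr1 ltxx.
(* A fixed-point equation for the derived series, read off partial sums shifted by m: the first m
   coefficients come from [pseries_diffs_rcons1_lt], the others from [pseries_diffs_rcons1D]. *)
suff H : limn (pseries d x) =
    m%:R * limn (pseries (a k) x) + x ^+ m * limn (pseries d x).
  apply: (mulIf x1n); rewrite mulrBr mulr1 {1}H mulrC /Aser.
  by field.
apply/cvg_lim => //; rewrite -(cvg_shiftn m).
have -> : [sequence pseries d x (n + m)%N]_n =
  (fun n => m%:R * pseries (a k) x (n + m)%N + x ^+ m * pseries d x n).
  apply/funext => n; rewrite /pseries /series /= addnC.
  elim: n => [|n IH].
    rewrite addn0 [X in _ + _ * X]big_geq // mulr0 addr0 mulr_sumr.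
    rewrite big_nat [RHS]big_nat; apply: eq_bigr => i /andP[_ im].
    by rewrite /d pseries_diffs_rcons1_lt // mulrA.
  rewrite addnS !big_nat_recr //= IH /d [(m + n)%N]addnC pseries_diffs_rcons1D.
  by rewrite exprD; ring.
apply: cvgD; apply: cvgMl_tmp => //.
by move: ca; rewrite -(cvg_shiftn m); exact.
Qed.
End Coef.

(** * Growth at 1 *)

Lemma is_derive_continuous (R : realType) (F : R -> R) (x l : R) :
  is_derive x (1 : R) F l -> {for x, continuous F}.
Proof.
move=> [dF _]; apply: differentiable_continuous; exact/derivable1_diffP.
Qed.

(** Plays the role of monotonicity of the integral. The right end is excluded because the series may
    diverge at 1. *)
Lemma ler_is_derive (R : realType) (a b : R) (F G f g : R -> R) :
  (forall y, a <= y < b -> is_derive y (1 : R) F (f y)) ->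
  (forall y, a <= y < b -> is_derive y (1 : R) G (g y)) ->
  (forall y, a < y < b -> f y <= g y) ->
  F a <= G a ->
  forall x, a <= x < b -> F x <= G x.
Proof.
move=> dF dG fg Fa x /andP[]; rewrite le_eqVlt => /predU1P[<- //|ax xb].
have dGF y : a <= y < b -> is_derive y (1 : R) (G - F) (g y - f y).
  by move=> yab; have := dF _ yab; have := dG _ yab; exact: is_deriveB.
have [|| c] := @MVT _ (G - F) (fun y => g y - f y) a x ax.
- move=> y; rewrite in_itv /= => /andP[ay yx]; apply: dGF.
  by rewrite (ltW ay) (lt_trans yx).
- apply: continuous_in_subspaceT => y; rewrite inE /= in_itv /= => /andP[ay yx].
  by apply/is_derive_continuous/dGF; rewrite ay (le_lt_trans yx).
rewrite in_itv /= => /andP[ac cx] H.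
suff : 0 <= (G - F) x - (G - F) a by rewrite !fctE; lra.
rewrite H mulr_ge0 ?subr_ge0 //; last exact: ltW.
by apply: fg; rewrite ac (lt_trans cx).
Qed.

Lemma eqr_is_derive (R : realType) (a b : R) (F G f : R -> R) :
  (forall y, a <= y < b -> is_derive y (1 : R) F (f y)) ->
  (forall y, a <= y < b -> is_derive y (1 : R) G (f y)) ->
  F a = G a ->
  forall x, a <= x < b -> F x = G x.
Proof.
move=> dF dG Fa x xab; apply/eqP; rewrite eq_le.
apply/andP; split; apply: (ler_is_derive _ a b _ _ f f) => //; rewrite ?Fa //.
Qed.

Section Growth.
Variables (R : realType) (m : nat).
Hypothesis hm : (1 <= m)%N.
Implicit Types (k : seq nat) (n c : nat) (x : R).
Local Notation Aser := (Aser R m).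
Local Notation Bser := (Bser R m).
(** The primitive of m / (1 - x^m), which is -log(1 - x) for m = 1: the yardstick for growth at 1,
    and by [L_phi] what undoes t |-> f(t/m). *)
Definition Lser := Aser [:: 1%N].

Lemma w_ge0 x : 0 <= x < 1 -> 0 <= m%:R / (1 - x ^+ m).
Proof.
by move=> /andP[x0 x1]; rewrite divr_ge0 // subr_ge0 exprn_ile1 // ltW.
Qed.

Lemma normr_lt1 x : 0 <= x < 1 -> `|x| < 1.
Proof. by move=> /andP[x0 x1]; rewrite ger0_norm. Qed.

Lemma is_derive_L x : 0 <= x < 1 -> is_derive x (1 : R) Lser (m%:R / (1 - x ^+ m)).
Proof.
move=> /normr_lt1 x1; have := @is_derive_Aser_rcons1 R m hm [::] x isT x1.
by rewrite Aser_nil mul1r.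
Qed.

Lemma L0 : Lser 0 = 0. Proof. exact: Aser0. Qed.

Lemma L_ge0 x : 0 <= x < 1 -> 0 <= Lser x.
Proof.
apply: (@ler_is_derive _ 0 1 (cst 0) Lser (fun=> 0) (fun y => m%:R / (1 - y ^+ m))).
- exact: is_derive_L.
- by move=> y /andP[y0 y1]; rewrite w_ge0 // (ltW y0).
- by rewrite L0.
Qed.

Lemma is_derive_LX n x : 0 <= x < 1 ->
  is_derive x (1 : R) (fun y => Lser y ^+ n.+1)
    (n.+1%:R * Lser x ^+ n * (m%:R / (1 - x ^+ m))).
Proof.
move=> x01; have dL := is_derive_L _ x01.
by have := @is_deriveX _ _ _ n.+1 x 1 _ dL; rewrite exprfctE.
Qed.

Lemma Aser_nseq1 n x : 0 <= x < 1 -> Aser (nseq n 1%N) x = Lser x ^+ n / n`!%:R.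
Proof.
elim: n x => [|n IH] x; first by rewrite Aser_nil expr0 divr1.
apply: (@eqr_is_derive _ 0 1 _ (fun y => Lser y ^+ n.+1 / (n.+1)`!%:R)
  (fun y => Lser y ^+ n / n`!%:R * (m%:R / (1 - y ^+ m)))).
- move=> y y01; rewrite -addn1 nseqD cats1 -IH //.
  by apply: is_derive_Aser_rcons1; [exact: hm|by rewrite all_nseq orbT|exact: normr_lt1].
- move=> y y01; have dL := is_derive_LX n _ y01.
  have := @is_deriveZ _ _ _ _ (n.+1)`!%:R^-1 y 1 _ dL.
  have -> : ((n.+1)`!%:R^-1 \*: (fun y : R => Lser y ^+ n.+1)) =
    (fun x0 : R => Lser x0 ^+ n.+1 / (n.+1)`!%:R).
    by apply/funext => z; rewrite mulrC.
  congr is_derive; rewrite factS natrM /GRing.scale /=.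
  have : n.+1%:R != 0 :> R by [].
  have : n`!%:R != 0 :> R by rewrite pnatr_eq0 -lt0n fact_gt0.
  move: (m%:R / _) n.+1%:R n`!%:R => z s t t0 s0; field.
  by rewrite s0 t0.
- by rewrite L0 expr0n mul0r Aser0 //; rewrite all_nseq orbT.
Qed.

Lemma ler_pseries (u v : nat -> R) x : 0 <= x ->
  cvgn (pseries u x) -> cvgn (pseries v x) -> (forall n, u n <= v n) ->
  limn (pseries u x) <= limn (pseries v x).
Proof.
move=> x0 cu cv uv; apply: ler_lim => //; near=> N.
by apply: ler_sum => i _; rewrite ler_wpM2r // exprn_ge0.
Unshelve. all: by end_near. Qed.

Lemma Aser_ge0 k x : all (leq 1) k -> 0 <= x < 1 -> 0 <= Aser k x.
Proof.
move=> k0 x01; have ca := is_cvg_acoef _ _ _ _ k0 (normr_lt1 _ x01).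
apply: limr_ge => //; near=> N; apply: sumr_ge0 => i _.
by rewrite mulr_ge0 ?acoef_ge0 // exprn_ge0 //; case/andP: x01.
Unshelve. all: by end_near. Qed.

Lemma Bser_ge0 k x : all (leq 1) k -> 0 <= x < 1 -> 0 <= Bser k x.
Proof.
move=> k0 x01; have ca := is_cvg_acoefS _ _ _ _ k0 (normr_lt1 _ x01).
apply: limr_ge => //; near=> N; apply: sumr_ge0 => i _.
by rewrite mulr_ge0 ?acoef_ge0 // exprn_ge0 //; case/andP: x01.
Unshelve. all: by end_near. Qed.

Lemma acoef_rcons_le1 k c n : (1 <= c)%N ->
  acoef R m (rcons k c) n <= acoef R m (rcons k 1%N) n.
Proof.
move=> c1; rewrite !acoef_rcons lerMn2r; apply/orP; right.
case: n => [|n]; first by rewrite big_ord0 mulr0 !mul0r.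
rewrite ler_wpM2l ?mulr_ge0 ?sumr_ge0 // => [i _|]; first exact: acoef_ge0.
by rewrite lef_pV2 ?posrE ?exprn_gt0 // ler_weXn2l // ler1n.
Qed.

(** Replacing the last entry by 1 can only increase the coefficients. With L for [Lser] and r for
    [size k], the derivative of A(k, 1; x) is at most L^r L', hence at most (r+1) L^r L' =
    (L^(r+1))'. The factor given away is harmless: only the order of growth matters. *)
Lemma Aser_le_L k x : all (leq 1) k -> 0 <= x < 1 -> Aser k x <= Lser x ^+ size k.
Proof.
elim/last_ind: k x => [|k c IH] x; first by rewrite Aser_nil expr0.
rewrite all_rcons size_rcons => /andP[c0 k0] x01.
apply: (@le_trans _ _ (Aser (rcons k 1%N) x)).
  have [/andP[x0 _] x1] := (x01, normr_lt1 _ x01).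
  apply: ler_pseries => //; last by move=> n; exact: acoef_rcons_le1.
    by apply: is_cvg_acoef => //; rewrite all_rcons c0.
  by apply: is_cvg_acoef => //; rewrite all_rcons.
move: x x01; apply: (@ler_is_derive _ 0 1 (Aser (rcons k 1%N))
  (fun y => Lser y ^+ (size k).+1)
  (fun y => Aser k y * (m%:R / (1 - y ^+ m)))
  (fun y => (size k).+1%:R * Lser y ^+ size k * (m%:R / (1 - y ^+ m)))).
- by move=> y y01; apply: is_derive_Aser_rcons1 => //; exact: normr_lt1.
- exact: is_derive_LX.
- move=> y /andP[y0 y1]; have y01 : 0 <= y < 1 by rewrite ltW.
  rewrite ler_wpM2r ?w_ge0 // (le_trans (IH _ k0 y01)) //.
  by rewrite ler_peMl ?exprn_ge0 ?L_ge0 // ler1n.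
- by rewrite L0 expr0n Aser0 //; [case: (k)|rewrite all_rcons].
Qed.

(* [Q] comes from integrating [Lser ^+ n] by parts against [d(1 - x)], using
   [Lser' <= m / (1 - x)]. *)
Lemma dominate_LX n : exists Q q : R -> R,
  [/\ forall x, 0 <= x < 1 -> is_derive x (1 : R) Q (q x),
      forall x, 0 <= x < 1 -> 0 <= Q x &
      forall x, 0 <= x < 1 -> q x <= - Lser x ^+ n].
Proof.
elim: n => [|n [Q [q [dQ Q0 qL]]]].
  exists (fun x => 1 - x), (fun=> -1); split => x /andP[x0 x1].
  - have := is_deriveB (is_derive_cst (1 : R) x (1 : R)) (is_derive_id x (1 : R)).
    by congr is_derive; rewrite sub0r.
  - by lra.
  - by rewrite expr0.
exists (fun x => (1 - x) * Lser x ^+ n.+1 + n.+1%:R * m%:R * Q x).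
exists (fun x => - Lser x ^+ n.+1
  + (1 - x) * (n.+1%:R * Lser x ^+ n * (m%:R / (1 - x ^+ m)))
  + n.+1%:R * m%:R * q x).
split => x x01; have [/andP[x0 x1] Lx] := (x01, L_ge0 _ x01).
- have d1 : is_derive x (1 : R) (fun x => 1 - x) (-1).
    have := is_deriveB (is_derive_cst (1 : R) x (1 : R)) (is_derive_id x (1 : R)).
    by congr is_derive; rewrite sub0r.
  have d2 := @is_deriveM _ _ _ _ _ _ _ _ d1 (is_derive_LX n _ x01).
  have d3 := @is_deriveZ _ _ _ _ (n.+1%:R * m%:R) x 1 _ (dQ _ x01).
  have := @is_deriveD _ _ _ _ _ _ _ _ _ d2 d3.
  by congr is_derive; rewrite /GRing.scale /=; ring.
- by rewrite addr_ge0 ?mulr_ge0 ?exprn_ge0 ?Q0 //; lra.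
- have := qL _ x01; rewrite -(ler_pM2l (_ : 0 < n.+1%:R * m%:R :> R)); last first.
    by rewrite mulr_gt0 // ltr0n.
  suff : (1 - x) * (n.+1%:R * Lser x ^+ n * (m%:R / (1 - x ^+ m))) <=
    n.+1%:R * m%:R * Lser x ^+ n by lra.
  have xm : x ^+ m <= x by rewrite -[leRHS]expr1 ler_wiXn2l // ltW.
  have -> : (1 - x) * (n.+1%:R * Lser x ^+ n * (m%:R / (1 - x ^+ m))) =
    n.+1%:R * m%:R * Lser x ^+ n * ((1 - x) / (1 - x ^+ m)) by ring.
  rewrite ler_piMr ?mulr_ge0 ?exprn_ge0 // ler_pdivrMr ?mul1r; lra.
Qed.

(** The bound is on x g(x) because g will be built from quotients A(k; x) / x. On [1/2, 1[ it gives
    g <= 2 L^n <= -2 Q', with L for [Lser], so G + 2 Q does not increase there; below 1/2 the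
    monotonicity of G suffices. *)
Lemma bounded_of_LX n (G g : R -> R) :
  (forall x, 0 <= x < 1 -> is_derive x (1 : R) G (g x)) ->
  (forall x, 0 <= x < 1 -> 0 <= x * g x <= Lser x ^+ n) ->
  (forall x y, 0 <= x -> x <= y -> y < 1 -> G x <= G y) /\
  exists M, forall x, 0 <= x < 1 -> G x <= M.
Proof.
move=> dG gL.
have mono x y : 0 <= x -> x <= y -> y < 1 -> G x <= G y.
  move=> x0 xy y1.
  apply: (@ler_is_derive _ x 1 (cst (G x)) G (fun=> 0) g _ _ _ _ y); rewrite ?xy //.
  - by move=> z /andP[xz z1]; apply: dG; rewrite (le_trans x0).
  - move=> z /andP[xz z1]; have z0 : 0 < z by exact: le_lt_trans xz.
    by have := gL z; rewrite (ltW z0) z1 => /(_ isT) /andP[]; rewrite pmulr_rge0.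
split=> //; have [Q [q [dQ Q0 qL]]] := dominate_LX n.
exists (G 2^-1 + 2 * Q 2^-1) => x /andP[x0 x1].
have G2 : forall y, 2^-1 <= y < 1 -> G y <= G 2^-1 + 2 * Q 2^-1 - 2 * Q y.
  apply: (@ler_is_derive _ 2^-1 1 G _ g (fun y => 0 - 2 * q y)).
  - by move=> y y01; apply: dG; lra.
  - move=> y y01; have y01' : 0 <= y < 1 by lra.
    have := is_deriveB
     (is_derive_cst (G 2^-1 + 2 * Q 2^-1 : R) y (1 : R))
     (@is_deriveZ _ _ _ _ 2 y 1 _ (dQ _ y01')).
    by [].
  - move=> y /andP[y2 y1]; have y01 : 0 <= y < 1 by lra.
    have /andP[g0 gl] := gL _ y01; have ql := qL _ y01.
    suff : g y <= 2 * (y * g y) by lra.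
    have : 0 <= g y by rewrite pmulr_rge0 in g0 => //; lra.
    by nra.
  - by lra.
have [x2|x2] := leP 2^-1 x.
  have := G2 x; rewrite x2 x1 => /(_ isT) H.
  by have := Q0 x; rewrite x0 x1 => /(_ isT); lra.
have : G x <= G 2^-1 by apply: mono; lra.
by have := Q0 2^-1; lra.
Qed.

Lemma cvg_at_left1 (G : R -> R) M :
  (forall x y, 0 <= x -> x <= y -> y < 1 -> G x <= G y) ->
  (forall x, 0 <= x < 1 -> G x <= M) ->
  cvg (G x @[x --> 1^'-]) /\
  forall x, 0 <= x < 1 -> G x <= lim (G x @[x --> 1^'-]).
Proof.
move=> mono GM.
have near01 : \forall x \near (1:R)^'-, 0 < x < 1.
  near=> x; apply/andP; split; near: x; [|exact: nbhs_left_lt].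
  exact: nbhs_left_gt.
have cG : cvg (G x @[x --> 1^'-]).
  apply: nondecreasing_at_left_is_cvgr; apply: filterS near01 => z /andP[z0 z1].
    move=> x y; rewrite !in_itv /= => /andP[zx x1] /andP[zy y1] xy.
    by apply: mono => //; lra.
  exists M => v /= [y]; rewrite in_itv /= => /andP[zy y1] <-.
  by apply: GM; lra.
split=> // x /andP[x0 x1]; apply: limr_ge => //; near=> y.
have xy : x <= y by near: y; exact: nbhs_left_ge.
by apply: mono.
Unshelve. all: by end_near. Qed.
End Growth.

(** * Integration by parts *)

Lemma near_left1 (R : realType) (P : R -> Prop) :
  (forall x, 0 <= x < 1 -> P x) -> \forall x \near (1:R)^'-, P x.
Proof.
move=> H; near=> x; apply: H; apply/andP; split; near: x; last exact: nbhs_left_lt.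
exact: nbhs_left_ge.
Unshelve. all: by end_near. Qed.

Lemma continuous_antiderivative (R : realType) (a b : R) (g : R -> R) :
  (forall y, a <= y < b -> {for y, continuous g}) ->
  forall x, a < x < b ->
  is_derive x (1 : R) (fun y => \int[lebesgue_measure]_(t in `[a, y]) g t) (g x).
Proof.
move=> cg x /andP[ax xb].
pose u := (x + b) / 2.
have xu : x < u by rewrite /u; lra.
have ub : u < b by rewrite /u; lra.
have ig : lebesgue_measure.-integrable `[a, u] (EFin \o g).
  apply: continuous_compact_integrable; first exact: segment_compact.
  apply: continuous_in_subspaceT => y; rewrite inE /= in_itv /= => /andP[ay yx].
  by apply: cg; rewrite ay (le_lt_trans yx).
have cgx : {for x, continuous g} by apply: cg; rewrite (ltW ax).
have [dF F'] := continuous_FTC1_closed xu ig ax cgx.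
by constructor; [exact: dF|rewrite -derive1E].
Qed.

Section Parts.
Variables (R : realType) (m : nat).
Hypothesis hm : (1 <= m)%N.
Implicit Types (k l : seq nat) (n c e : nat) (x : R).
Local Notation Aser := (Aser R m).
Local Notation Bser := (Bser R m).
Local Notation a := (acoef R m).

(** Abel's theorem for nonnegative coefficients, convergence of T included: the limit at 1 exists by
    boundedness and dominates every partial sum of the coefficients, so their series converges;
    conversely x^n <= 1 bounds A by that series. *)
Lemma cvg_Aser_T k c : all (leq 1) k -> (2 <= c)%N ->
  Aser (rcons k c) x @[x --> 1^'-] --> T m k (c%:R : R).
Proof.
case: c => [//|c] k0 c1.
have kc : all (leq 1) (rcons k c.+1) by rewrite all_rcons k0.
have [mono [M bd]] : (forall x y, 0 <= x -> x <= y -> y < 1 ->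
      Aser (rcons k c.+1) x <= Aser (rcons k c.+1) y) /\
    exists M, forall x, 0 <= x < 1 -> Aser (rcons k c.+1) x <= M.
  apply: (@bounded_of_LX _ _ hm (size (rcons k c)) _ (Bser (rcons k c))).
    by move=> x x01; apply: is_derive_Aser_rconsS => //; exact: normr_lt1.
  move=> x x01; have kc' : all (leq 1) (rcons k c) by rewrite all_rcons k0 andbT.
  rewrite -Aser_Bser //; last 2 first.
  - by case: (k).
  - exact: normr_lt1.
  by rewrite Aser_ge0 //= Aser_le_L.
have [cA Al] := cvg_at_left1 _ _ _ mono bd.
set l := lim _ in Al.
have sl N : series (a (rcons k c.+1)) N <= l.
  have cp : (\sum_(0 <= i < N) a (rcons k c.+1) i * x ^+ i) @[x --> (1:R)^'-] -->
     series (a (rcons k c.+1)) N.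
    apply: cvg_at_left_filter.
    have -> : series (a (rcons k c.+1)) N =
      \sum_(0 <= i < N) a (rcons k c.+1) i * 1 ^+ i.
      by apply: eq_bigr => i _; rewrite expr1n mulr1.
    elim: N => [|N IH].
      by under eq_fun do rewrite big_nil; rewrite big_nil; exact: cvg_cst.
    under eq_fun do rewrite big_nat_recr //; rewrite big_nat_recr //.
    by apply: cvgD => //; apply: cvgMl_tmp; exact: exprn_continuous.
  rewrite -(cvg_lim _ cp) //; apply: limr_le; first by apply/cvg_ex; eexists; exact: cp.
  apply: near_left1 => x x01; apply: le_trans (Al _ x01).
  apply: (nondecreasing_cvgn_le (u_ := pseries (a (rcons k c.+1)) x)).
    apply/nondecreasing_seqP => n.
    rewrite /pseries /series /= big_nat_recr //= lerDl mulr_ge0 ?acoef_ge0 //.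
    by rewrite exprn_ge0; case/andP: x01.
  by apply: is_cvg_acoef => //; exact: normr_lt1.
have cs : cvgn (series (a (rcons k c.+1))).
  apply: nondecreasing_is_cvgn; last by exists l => _ [N _ <-].
  apply/nondecreasing_seqP => n.
  by rewrite /series /= big_nat_recr //= lerDl acoef_ge0.
rewrite (T_series R m hm k c.+1 cs).
suff <- : l = limn (series (a (rcons k c.+1))) by [].
apply/eqP; rewrite eq_le; apply/andP; split; last first.
  by apply: limr_le => //; near=> N; exact: sl.
apply: limr_le => //; apply: near_left1 => x x01.
apply: ler_lim => //; first by apply: is_cvg_acoef => //; exact: normr_lt1.
near=> N; apply: ler_sum => i _; rewrite ler_piMr ?acoef_ge0 //.
by case/andP: x01 => x0 x1; rewrite exprn_ile1 // ltW.
Unshelve. all: by end_near. Qed.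

(* The primitive of A(k; x) A(l; x) / x vanishing at 0; integrating from -1/2
   makes it differentiable on both sides of 0. *)
Definition Hser k l x : R :=
  let F y := \int[lebesgue_measure]_(t in `[- 2^-1, y]) (t * Bser k t * Bser l t) in
  F x - F 0.

Lemma Hser0 k l : Hser k l 0 = 0. Proof. exact: subrr. Qed.

Lemma continuous_Bser k x : all (leq 1) k -> `|x| < 1 -> {for x, continuous (Bser k)}.
Proof.
move=> k0 x1; apply: is_derive_continuous.
by apply: is_derive_pseries => // y y1; exact: is_cvg_acoefS.
Qed.

Lemma is_derive_Hser k l x : all (leq 1) k -> all (leq 1) l -> 0 <= x < 1 ->
  is_derive x (1 : R) (Hser k l) (x * Bser k x * Bser l x).
Proof.
move=> k0 l0 /andP[x0 x1].
have H : is_derive x (1 : R) (fun y => \int[lebesgue_measure]_(t in `[- 2^-1, y])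
    (t * Bser k t * Bser l t)) (x * Bser k x * Bser l x).
  apply: (@continuous_antiderivative _ (- 2^-1) 1
     (fun t => t * Bser k t * Bser l t)); last by apply/andP; split; lra.
  move=> y /andP[y0 y1].
  have y1' : `|y| < 1 by rewrite ltr_norml; apply/andP; split; lra.
  apply: continuousM; last exact: continuous_Bser.
  apply: continuousM; last exact: continuous_Bser.
  exact: cvg_id.
have := is_deriveB H (is_derive_cst _ _ _).
by rewrite subr0; exact.
Qed.

(** Here x times the derivative is A(k; x) A(l; x), bounded by a power of [Lser]; both words may
    thus end in 1. *)
Lemma Hser_cvg k l : k != [::] -> l != [::] ->
  all (leq 1) k -> all (leq 1) l -> cvg (Hser k l x @[x --> 1^'-]).
Proof.
move=> kn ln k0 l0.
have [mono [M bd]] : (forall x y, 0 <= x -> x <= y -> y < 1 ->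
      Hser k l x <= Hser k l y) /\
    exists M, forall x, 0 <= x < 1 -> Hser k l x <= M.
  apply: (@bounded_of_LX _ _ hm (size k + size l) _ (fun x => x * Bser k x * Bser l x)).
    by move=> x x01; exact: is_derive_Hser.
  move=> x x01; have x1 := normr_lt1 _ _ x01.
  have -> : x * (x * Bser k x * Bser l x) = Aser k x * Aser l x.
    by rewrite !Aser_Bser //; ring.
  by rewrite mulr_ge0 ?Aser_ge0 //= exprD ler_pM ?Aser_ge0 ?Aser_le_L.
by have [] := cvg_at_left1 _ _ _ mono bd.
Qed.

(** The integral I(k, l), improper only at 1. *)
Definition Ilim k l : R := lim (Hser k l x @[x --> 1^'-]).

Lemma HserC k l : Hser k l = Hser l k.
Proof.
apply/funext => x; rewrite /Hser /=.
by congr (_ - _); apply: eq_Rintegral => t _; rewrite mulrAC.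
Qed.

(** The two integrands add up to the derivative of A(k, c+1; x) A(l, e+1; x), which vanishes at 0;
    both last entries are at least 2, so each factor tends to a T-value at 1. *)
Lemma Ilim_parts k l c e : all (leq 1) k -> all (leq 1) l ->
  (1 <= c)%N -> (1 <= e)%N ->
  Ilim (rcons k c) (rcons l e.+1) + Ilim (rcons k c.+1) (rcons l e) =
  T m k (c.+1%:R : R) * T m l (e.+1%:R : R).
Proof.
move=> k0 l0 c0 e0.
have r_n s i : rcons s i != [::] :> seq nat by case: s.
have ap s i : all (leq 1) s -> (1 <= i)%N -> all (leq 1) (rcons s i).
  by move=> s0 i0; rewrite all_rcons i0.
have k1 := ap _ c.+1 k0 isT; have l1 := ap _ e.+1 l0 isT.
have E x : 0 <= x < 1 ->
    Hser (rcons k c) (rcons l e.+1) x + Hser (rcons k c.+1) (rcons l e) x =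
    Aser (rcons k c.+1) x * Aser (rcons l e.+1) x.
  apply: (@eqr_is_derive _ 0 1
    (Hser (rcons k c) (rcons l e.+1) + Hser (rcons k c.+1) (rcons l e))
    (Aser (rcons k c.+1) * Aser (rcons l e.+1))
    (fun x => x * Bser (rcons k c) x * Bser (rcons l e.+1) x +
       x * Bser (rcons k c.+1) x * Bser (rcons l e) x)).
  - by move=> y y01; apply: is_deriveD; apply: is_derive_Hser => //; exact: ap.
  - move=> y y01; have y1 := normr_lt1 _ _ y01.
    have := is_deriveM (is_derive_Aser_rconsS R m k c y k0 c0 y1)
                      (is_derive_Aser_rconsS R m l e y l0 e0 y1).
    congr is_derive; rewrite /GRing.scale /=.
    rewrite (Aser_Bser _ _ (rcons k c.+1)) // (Aser_Bser _ _ (rcons l e.+1)) //.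
    by ring.
  - rewrite !fctE !Hser0 (Aser0 _ _ (rcons k c.+1)) //.
    by rewrite mul0r addr0.
have cI1 := @Hser_cvg _ _ (r_n k c) (r_n l e.+1) (ap _ _ k0 c0) l1.
have cI2 := @Hser_cvg _ _ (r_n k c.+1) (r_n l e) k1 (ap _ _ l0 e0).
have c1 := cvgD cI1 cI2.
have c2 := cvgM (cvg_Aser_T k c.+1 k0 c0) (cvg_Aser_T l e.+1 l0 e0).
rewrite -(cvg_lim _ (c2 _)) //; apply/esym/cvg_lim => //.
apply: cvg_trans (c1 _); apply: near_eq_cvg.
by apply: near_left1 => x x01; rewrite /= -E.
Qed.

(** In the derivative of the difference the two terms A(k, c+1; x) A(l, e+1; x) m / (1 - x^m) cancel
    pointwise, so their pole at 1 is never integrated. What remains has convergent primitives, which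
    gives both the existence and the value of the limit. *)
Lemma cvg_Aser_diff k l c e : all (leq 1) k -> all (leq 1) l ->
  (1 <= c)%N -> (1 <= e)%N ->
  Aser (rcons k c.+1) x * Aser (rcons (rcons l e.+1) 1%N) x
    - Aser (rcons (rcons k c.+1) 1%N) x * Aser (rcons l e.+1) x @[x --> 1^'-] -->
  Ilim (rcons k c) (rcons (rcons l e.+1) 1%N)
    - Ilim (rcons (rcons k c.+1) 1%N) (rcons l e).
Proof.
move=> k0 l0 c0 e0.
have r_n s i : rcons s i != [::] :> seq nat by case: s.
have ap s i : all (leq 1) s -> (1 <= i)%N -> all (leq 1) (rcons s i).
  by move=> s0 i0; rewrite all_rcons i0.
have k1 := ap _ c.+1 k0 isT; have l1 := ap _ e.+1 l0 isT.
have k2 := ap _ 1%N k1 isT; have l2 := ap _ 1%N l1 isT.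
have E x : 0 <= x < 1 ->
    Hser (rcons k c) (rcons (rcons l e.+1) 1%N) x
      - Hser (rcons (rcons k c.+1) 1%N) (rcons l e) x =
    Aser (rcons k c.+1) x * Aser (rcons (rcons l e.+1) 1%N) x
    - Aser (rcons (rcons k c.+1) 1%N) x * Aser (rcons l e.+1) x.
  apply: (@eqr_is_derive _ 0 1
    (Hser (rcons k c) (rcons (rcons l e.+1) 1%N)
      - Hser (rcons (rcons k c.+1) 1%N) (rcons l e))
    (Aser (rcons k c.+1) * Aser (rcons (rcons l e.+1) 1%N)
      - Aser (rcons (rcons k c.+1) 1%N) * Aser (rcons l e.+1))
    (fun x => x * Bser (rcons k c) x * Bser (rcons (rcons l e.+1) 1%N) x
       - x * Bser (rcons (rcons k c.+1) 1%N) x * Bser (rcons l e) x)).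
  - by move=> y y01; apply: is_deriveB; apply: is_derive_Hser => //; exact: ap.
  - move=> y y01; have y1 := normr_lt1 _ _ y01.
    have d1 := is_derive_Aser_rconsS R m k c y k0 c0 y1.
    have d2 := is_derive_Aser_rcons1 R m hm _ _ l1 y1.
    have d3 := is_derive_Aser_rcons1 R m hm _ _ k1 y1.
    have d4 := is_derive_Aser_rconsS R m l e y l0 e0 y1.
    have := is_deriveB (is_deriveM d1 d2) (is_deriveM d3 d4).
    congr is_derive; rewrite /GRing.scale /=.
    rewrite (@Aser_Bser _ _ (rcons (rcons k _) _)) //.
    rewrite (@Aser_Bser _ _ (rcons (rcons l _) _)) //.
    by ring.
  - rewrite !fctE !Hser0 (Aser0 _ _ (rcons k c.+1)) // (Aser0 _ _ (rcons l e.+1)) //.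
    by rewrite mul0r mulr0 subrr.
have cI1 := @Hser_cvg _ _ (r_n k c) (r_n _ 1%N) (ap _ _ k0 c0) l2.
have cI2 := @Hser_cvg _ _ (r_n _ 1%N) (r_n l e) k2 (ap _ _ l0 e0).
apply: cvg_trans (cvgB cI1 cI2); apply: near_eq_cvg.
by apply: near_left1 => x x01; rewrite -E.
Qed.
End Parts.

(** * The Gamma function at the integers *)

(** Behaviour at 0 is described by right limits because nothing is known of f on negative arguments.
    Integrability comes from the sign of g and the limit of F. *)
Lemma Rintegral_ge0_FTC_oy (R : realType) (g F : R -> R) (l : R) :
  (forall t, 0 <= t -> 0 <= g t) ->
  (forall t : R, 0 < t -> {for t, continuous g}) ->
  g t @[t --> 0^'+] --> g 0 ->
  (forall t : R, 0 < t -> is_derive t (1 : R) F (g t)) ->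
  F t @[t --> 0^'+] --> F 0 ->
  F t @[t --> +oo] --> l ->
  \int[lebesgue_measure]_(t in `]0, +oo[) g t = l - F 0.
Proof.
move=> g0 cg cg0 dF cF0 cFy.
have cg' : {in `]0, +oo[, continuous g}.
  by move=> t; rewrite in_itv /= andbT => /cg.
rewrite /Rintegral integral_itv_obnd_cbnd; last first.
  apply/measurable_realfun.measurable_EFinP.
  apply: measurable_realfun.open_continuous_measurable_fun.
    exact: interval_open.
  by move=> t; rewrite inE /=; exact: cg'.
rewrite (@ge0_continuous_FTC2y _ g F 0 l) //.
- by apply/continuous_within_itvcyP; split.
- by move=> t /dF[].
- move=> t; rewrite in_itv /= andbT => /dF dFt.
  by rewrite derive1E (@derive_val _ _ _ _ _ _ _ dFt).
Qed.

Lemma cvg_expRN_Xn (R : realType) n : t ^+ n * expR (- t) @[t --> +oo] --> (0 : R).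
Proof.
apply/cvgrPdist_le => e e0; near=> t.
have t0 : 0 < t by [].
rewrite sub0r normrN ger0_norm; last by rewrite mulr_ge0 ?expR_ge0 // exprn_ge0 // ltW.
rewrite expRN ler_pdivrMr ?expR_gt0 //.
have et : n.+1`!%:R / e <= t by [].
(* The exponential exceeds t^(n+1) / (n+1)!, so the quotient is at most (n+1)! / t; hence the
   threshold (n+1)! / [e] for t. *)
have H := expR_ge1Dxn n (ltW t0).
have f0 : 0 < n.+1`!%:R :> R by rewrite ltr0n fact_gt0.
apply: (@le_trans _ _ (e * (t ^+ n.+1 / n.+1`!%:R))).
  have -> : e * (t ^+ n.+1 / n.+1`!%:R) = t ^+ n * (t * e / n.+1`!%:R).
    by rewrite exprS; ring.
  rewrite ler_peMr ?exprn_ge0 ?(ltW t0) //.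
  by rewrite ler_pdivlMr // mul1r -ler_pdivrMr.
by rewrite ler_pM2l //; lra.
Unshelve. all: by end_near. Qed.

Lemma Gamma_nat (R : realType) n : Gamma (n.+1%:R : R) = n`!%:R.
Proof.
have [F [dF F0 Fy]] : exists F : R -> R,
  [/\ forall t, is_derive t (1 : R) F (t ^+ n * expR (- t)),
      F 0 = - n`!%:R & F t @[t --> +oo] --> (0 : R)].
  have dE t : is_derive t (1 : R) (fun t => expR (- t)) (- expR (- t)).
    have := is_derive1_comp (is_derive_expR (- t)) (is_deriveNid t (1 : R)).
    by rewrite mulrN1.
  elim: n => [|n [F [dF F0 Fy]]].
    exists (fun t => - expR (- t)); split.
    - by move=> t; have := is_deriveN (dE t); rewrite opprK expr0 mul1r.
    - by rewrite oppr0 expR0.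
    - by rewrite -oppr0; apply: cvgN; exact: cvgr_expR.
  (* Integration by parts on primitives: the new term vanishes at 0 and at infinity, so the value at
     0 is multiplied by n + 1. *)
  exists (fun t => n.+1%:R * F t - t ^+ n.+1 * expR (- t)); split.
  - move=> t.
    have dX : is_derive t (1 : R) (fun t => t ^+ n.+1) (n.+1%:R * t ^+ n).
      have := @is_deriveX _ _ _ n.+1 _ _ _ (is_derive_id t (1 : R)).
      by rewrite exprfctE /GRing.scale /= mulr1.
    have := is_deriveB (@is_deriveZ _ _ _ _ n.+1%:R _ _ _ (dF t)) (is_deriveM dX (dE t)).
    by congr is_derive; rewrite /GRing.scale /=; ring.
  - by rewrite F0 expr0n mul0r subr0 factS natrM mulrN.
  - rewrite -[X in _ --> X]subr0 -{1}(mulr0 n.+1%:R); apply: cvgB; last exact: cvg_expRN_Xn.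
    exact: cvgMl_tmp.
have cg t : {for t, continuous (fun t : R => t ^+ n * expR (- t))}.
  apply: continuousM; first exact: exprn_continuous.
  by apply: continuous_comp; [exact: opp_continuous|exact: continuous_expR].
rewrite /Gamma.
transitivity (\int[lebesgue_measure]_(t in `]0, +oo[) (t ^+ n * expR (- t) : R)).
  apply: eq_Rintegral => t; rewrite inE /= in_itv /= andbT => t0.
  by rewrite -natr1 addrK powR_mulrn // ltW.
rewrite (@Rintegral_ge0_FTC_oy _ _ F 0) // ?F0 ?sub0r ?opprK //.
- by move=> t t0; rewrite mulr_ge0 ?expR_ge0 // exprn_ge0.
- by apply: cvg_at_right_filter; exact: cg.
- by rewrite -F0; apply: cvg_at_right_filter; exact: (is_derive_continuous _ _ _ _ (dF 0)).
Qed.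

(** * The change of variable x = f(t/m) *)

Section Fm.
Variables (R : realType) (m : nat) (f : R -> R).
Hypothesis hm : (1 <= m)%N.
Hypothesis hf : is_fm m f.

Lemma has_deriv_ge0P (z l : R) : has_deriv_ge0 f z l ->
  forall e, 0 < e -> \forall w \near z, w != z -> 0 <= w ->
    `|l - (f w - f z) / (w - z)| < e.
Proof.
move=> + e e0 => /cvgrPdist_lt /(_ e e0).
rewrite near_withinE /dnbhs near_withinE; apply: filterS => w H wz w0.
exact: H.
Qed.

Lemma is_derive_fm (z : R) : 0 < z -> is_derive z (1 : R) f (1 - f z ^+ m).
Proof.
move=> z0; have [df _ _ _] := hf; have [l dl lE] := df z (ltW z0).
have -> : 1 - f z ^+ m = l by rewrite -lE addrK.
(* For z > 0 the restriction 0 <= w in [has_deriv_ge0] holds near z, so the slope function, extended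
   by l at z, is continuous there. *)
apply/is_derive1_caratheodory.
exists (fun w => if w == z then l else (f w - f z) / (w - z)); split.
- move=> w; case: eqVneq => [->|wz]; first by rewrite !subrr mulr0.
  by rewrite divfK // subr_eq0.
- apply/cvgrPdist_lt => e e0; rewrite eqxx.
  have := has_deriv_ge0P _ _ dl _ e0.
  apply: filter_app; near=> w => H.
  case: eqVneq => [_|wz]; first by rewrite subrr normr0.
  have w0 : 0 < w by near: w; exact: lt_nbhsr.
  by apply: H => //; exact: ltW.
- by rewrite eqxx.
Unshelve. all: by end_near. Qed.

Lemma cvg_fm0 : f z @[z --> 0^'+] --> (0 : R).
Proof.
have [df _ f0 _] := hf; have [l dl _] := df 0 (lexx _).
have cq : (f w - f 0) / (w - 0) @[w --> 0^'+] --> l.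
  apply/cvgrPdist_lt => e e0; rewrite near_withinE.
  have := has_deriv_ge0P _ _ dl _ e0; apply: filterS => w H w0.
  by apply: H; [rewrite gt_eqF|exact: ltW].
have cw : w @[w --> (0:R)^'+] --> (0 : R) by apply: cvg_at_right_filter; exact: cvg_id.
have := cvgM cw cq; rewrite mul0r => c; apply: cvg_trans (c _).
apply: near_eq_cvg; rewrite near_withinE; near=> w => w0 /=.
by rewrite f0 !subr0 mulrC divfK // gt_eqF.
Unshelve. all: by end_near. Qed.

Let lnf' (z : R) : R :=
  m%:R ^+ 2 * expR (- (m%:R * z)) / (1 - expR (- (m%:R ^+ 2 * z))).

Lemma lnf'_gt0 z : 0 < z -> 0 < lnf' z.
Proof.
move=> z0; have m0 : 0 < m%:R :> R by rewrite ltr0n.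
rewrite divr_gt0 ?mulr_gt0 ?expR_gt0 ?exprn_gt0 // subr_gt0 expR_lt1.
by rewrite oppr_lt0 mulr_gt0 // exprn_gt0.
Qed.

(* [ln] vanishes on nonpositive reals, so [f z <= 0] would make [ln \o f] constant
   near [z]. *)
Lemma fm_gt0 (z : R) : 0 < z -> 0 < f z.
Proof.
move=> z0; rewrite ltNge; apply/negP => fz.
have [_ dlnf _ _] := hf; have dz := dlnf z z0.
have cln := is_derive_continuous _ _ _ _ dz.
have cf := is_derive_continuous _ _ _ _ (is_derive_fm z z0).
suff near0 : \near z, ln (f z) = cst 0 z.
  have d0 := near_eq_is_derive near0 dz.
  have := @derive_val _ _ _ _ _ _ _ d0; rewrite derive_cst => /esym/eqP.
  by rewrite gt_eqF // lnf'_gt0.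
(* Near z, continuity gives f < 1/2 and |ln f| < ln 2, whereas 0 < f < 1/2 would give ln f < - ln 2;
   hence f <= 0 near z. *)
have ln2 : 0 < ln 2 :> R by rewrite ln_gt0 //; lra.
have h2 : 0 < 2^-1 :> R by lra.
move/cvgrPdist_lt: cln => /(_ _ ln2); move/cvgrPdist_lt: cf => /(_ _ h2).
apply: filterS2 => w fw; rewrite (ln0 fz) sub0r normrN => lw.
have [fw0|fw0] := leP (f w) 0; first by rewrite ln0.
have fw2 : f w < 2^-1 by move: fw; rewrite ltr_norml; lra.
have : ln (f w) < - ln 2 by rewrite -lnV ?posrE // ltr_ln ?posrE.
by move: lw; rewrite ltr_norml; lra.
Qed.

Lemma fm_ode_log (z : R) : 0 < z -> 1 - f z ^+ m = lnf' z * f z.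
Proof.
move=> z0; have fz := fm_gt0 z z0.
have [_ dlnf _ _] := hf.
have d1 := is_derive1_comp (is_derive1_ln fz) (is_derive_fm z z0).
have := @derive_val _ _ _ _ _ _ _ d1.
rewrite (@derive_val _ _ _ _ _ _ _ (dlnf z z0)) -/(lnf' z) => ->.
by rewrite mulrAC mulVf ?mul1r // gt_eqF.
Qed.

(** By [fm_ode_log], 1 - f^m is a product of positive factors. *)
Lemma fm_lt1 (z : R) : 0 < z -> f z < 1.
Proof.
move=> z0; rewrite ltNge; apply/negP => f1.
have := mulr_gt0 (lnf'_gt0 z z0) (fm_gt0 z z0).
by rewrite -fm_ode_log // subr_gt0 ltNge exprn_ege1.
Qed.

Let phi (t : R) := f (t / m%:R).

Let m_gt0 : 0 < m%:R :> R. Proof. by rewrite ltr0n. Qed.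

Lemma phi_itv (t : R) : 0 < t -> 0 < f (t / m%:R) < 1.
Proof.
by move=> t0; rewrite fm_gt0 ?fm_lt1 // divr_gt0.
Qed.

Lemma phi_itv0 (t : R) : 0 <= t -> 0 <= f (t / m%:R) < 1.
Proof.
rewrite le_eqVlt => /predU1P[<-|t0].
  by rewrite mul0r; have [_ _ -> _] := hf; rewrite lexx ltr01.
by have /andP[/ltW -> ->] := phi_itv t t0.
Qed.

Lemma is_derive_phi (t : R) : 0 < t ->
  is_derive t (1 : R) phi ((1 - phi t ^+ m) / m%:R).
Proof.
move=> t0; have tm : 0 < t / m%:R by rewrite divr_gt0.
have d1 : is_derive t (1 : R) (fun t => t / m%:R) m%:R^-1.
  have := @is_deriveZ _ _ _ _ m%:R^-1 _ _ _ (is_derive_id t (1 : R)).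
  rewrite /GRing.scale /= mulr1; congr is_derive.
  by apply/funext => y; rewrite mulrC.
exact: (@is_derive1_comp _ f (fun t => t / m%:R) t _ _ (is_derive_fm _ tm) d1).
Qed.

(** Both sides are the logarithmic derivative of [phi]: the left one as prescribed, the right one
    from the differential equation. *)
Lemma psi_kernel (t : R) : 0 < t ->
  m%:R / (expR t - expR ((1 - m%:R) * t)) = (1 - phi t ^+ m) / m%:R / phi t.
Proof.
move=> t0; have tm : 0 < t / m%:R by rewrite divr_gt0.
have m0 : m%:R != 0 :> R by rewrite gt_eqF.
rewrite /phi fm_ode_log // mulrAC mulfK ?gt_eqF ?fm_gt0 // /lnf'.
have -> : m%:R * (t / m%:R) = t by field.
have -> : m%:R ^+ 2 * (t / m%:R) = m%:R * t by field.
have -> : expR ((1 - m%:R) * t) = expR t * expR (- (m%:R * t)).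
  by rewrite -expRD; congr expR; ring.
have d0 : 1 - expR (- (m%:R * t)) != 0.
  by rewrite gt_eqF // subr_gt0 expR_lt1 oppr_lt0 mulr_gt0.
rewrite (expRN t); have e0 : expR t != 0 by rewrite gt_eqF // expR_gt0.
move: d0; move: (expR (- (m%:R * t))) (expR t) e0 => y x x0 y0.
have -> : x - x * y = x * (1 - y) by ring.
by rewrite !invfM; field; rewrite x0 m0 y0.
Qed.

Lemma cvg_phi0 : phi t @[t --> 0^'+] --> (0 : R).
Proof.
apply/cvgrPdist_lt => e e0; rewrite near_withinE.
move/cvgrPdist_lt: cvg_fm0 => /(_ e e0); rewrite near_withinE => H.
have cm : t / m%:R @[t --> (0:R)] --> (0 / m%:R : R).
  apply: (@cvgMr_tmp R R (nbhs (0 : R)) _ id); exact: cvg_id.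
rewrite mul0r in cm.
have {H} := cm _ H; rewrite nbhs_simpl /=; apply: filterS => t Ht t0.
by apply: Ht; exact: divr_gt0.
Qed.

Lemma cvg_phiy : phi t @[t --> +oo] --> (1 : R)^'-.
Proof.
have cy : phi t @[t --> +oo] --> (1 : R).
  have [_ _ _ fy] := hf; apply: cvg_comp fy.
  by apply: gt0_cvgMly; [rewrite invr_gt0|exact: cvg_id].
have gt0 : \forall t \near +oo, 0 < (t : R) by exact: nbhs_pinfty_gt.
move=> B /cy HB; rewrite nbhs_simpl /=; apply: filterS2 gt0 HB => t t0 Bt; apply: Bt.
have /andP[_ p1] := phi_itv t t0; exact: p1.
Qed.

(** The derivatives m / (1 - x^m) of [Lser] and (1 - x^m) / m of [phi], at x = phi(t), multiply to
    1. The difference of the two sides is thus constant for t > 0, and its value is found by letting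
    t decrease to 0. *)
Lemma L_phi (t : R) : 0 < t -> Lser R m (phi t) = t.
Proof.
move=> t0.
have H s : 0 < s -> s <= t -> Lser R m (phi t) - t = Lser R m (phi s) - s.
  move=> s0 st.
  have E : Lser R m (phi t) = t + (Lser R m (phi s) - s).
    apply: (@eqr_is_derive _ s (t + 1) (Lser R m \o phi)
      (fun y => y + (Lser R m (phi s) - s)) (fun=> 1)); last 2 first.
    - by rewrite /=; lra.
    - by apply/andP; split=> //; lra.
    - move=> y /andP[sy yt]; have y0 : 0 < y by lra.
      have /andP[p0 p1] := phi_itv y y0.
      have p01 : 0 <= phi y < 1 by rewrite (ltW p0).
      have := is_derive1_comp (is_derive_L R m hm _ p01) (is_derive_phi y y0).
      have m0 : m%:R != 0 :> R by rewrite gt_eqF.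
      have q0 : 1 - phi y ^+ m != 0.
        by rewrite gt_eqF // subr_gt0 exprn_ilt1 // ?ltW // -lt0n.
      congr is_derive; field; by rewrite q0 m0.
    - move=> y _.
      have := is_deriveD (is_derive_id y (1 : R))
        (is_derive_cst (Lser R m (phi s) - s) y (1 : R)).
      by rewrite addr0.
  by rewrite E; ring.
have c1 : Lser R m (phi s) - s @[s --> 0^'+] --> (0 : R).
  rewrite -[X in _ --> X]subr0; apply: cvgB; last first.
    by apply: cvg_at_right_filter; exact: cvg_id.
  apply: cvg_comp cvg_phi0 _.
  have h01 : 0 <= (0 : R) < 1 by rewrite lexx ltr01.
  have cL : Lser R m x @[x --> (0 : R)] --> Lser R m 0.
    exact: (is_derive_continuous _ _ _ _ (is_derive_L R m hm 0 h01)).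
  by rewrite L0 in cL.
have c2 : Lser R m (phi s) - s @[s --> 0^'+] --> Lser R m (phi t) - t.
  apply: cvg_near_cst; near=> s; apply/esym/H => //.
  by near: s; exact: nbhs_right_le.
have /eqP : Lser R m (phi t) - t = 0 by exact: (cvg_unique (@Rhausdorff R) c2 c1).
by rewrite subr_eq0 => /eqP.
Unshelve. all: by end_near. Qed.

Lemma psi_Ilim k p : k != [::] -> all (leq 1) k -> (1 <= p)%N ->
  psi m f k (p.+1%:R) = Ilim R m (nseq p 1%N) k.
Proof.
move=> kn k0 p1.
set N := nseq p 1%N.
have N0 : all (leq 1) N by rewrite all_nseq orbT.
have Nn : N != [::] by rewrite /N; case: (p) p1.
have pf : p`!%:R != 0 :> R by rewrite pnatr_eq0 -lt0n fact_gt0.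
have phi0 : phi 0 = 0 by rewrite /phi mul0r; have [] := hf.
(* Chosen so that [h \o phi] is the derivative of p! [Hser] composed with [phi]; writing it with
   [Bser] keeps it continuous at 0. *)
pose h x : R := p`!%:R * (x * Bser R m N x * Bser R m k x) * ((1 - x ^+ m) / m%:R).
have ch x : `|x| < 1 -> {for x, continuous h}.
  move=> x1; apply: continuousM.
    apply: continuousM; first exact: cst_continuous.
    apply: continuousM; last exact: continuous_Bser.
    apply: continuousM; last exact: continuous_Bser.
    exact: cvg_id.
  apply: continuousM; last exact: cst_continuous.
  apply: continuousB; first exact: cst_continuous.
  exact: exprn_continuous.
rewrite /psi Gamma_nat.
have -> : \int[lebesgue_measure]_(t in `]0, +oo[)
    (t `^ (p.+1%:R - 1) * (m%:R / (expR t - expR ((1 - m%:R) * t)))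
      * A m k (f (t / m%:R))) = \int[lebesgue_measure]_(t in `]0, +oo[) h (phi t).
  apply: eq_Rintegral => t; rewrite inE /= in_itv /= andbT => t0.
  rewrite psi_kernel // -natr1 addrK powR_mulrn ?(ltW t0) //.
  have /andP[q0 q1] := phi_itv t t0.
  have q01 : 0 <= phi t < 1 by rewrite (ltW q0).
  rewrite A_Aser ?normr_lt1 // -/(phi t).
  have -> : t ^+ p = p`!%:R * Aser R m N (phi t).
    by rewrite Aser_nseq1 // L_phi // mulrC divfK.
  rewrite !Aser_Bser ?normr_lt1 // /h.
  have : phi t != 0 by rewrite gt_eqF.
  move: (phi t) (Bser _ _ _ _) (Bser _ _ _ _) ((1 - _) / _) => x y z w x0.
  by field.
transitivity (p`!%:R^-1 * (p`!%:R * Ilim R m N k - p`!%:R * Hser R m N k (phi 0))).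
  congr (_ * _); apply: (@Rintegral_ge0_FTC_oy _ (h \o phi)
    (fun t => p`!%:R * Hser R m N k (phi t))) => /=.
- move=> t t0; have q01 := phi_itv0 t t0; have /andP[q0 q1] := q01.
  rewrite /h !mulr_ge0 ?Bser_ge0 // ?invr_ge0 //.
  by rewrite subr_ge0 exprn_ile1 // ltW.
- move=> t t0; apply: continuous_comp.
    exact: (is_derive_continuous _ _ _ _ (is_derive_phi t t0)).
  by apply: ch; apply: normr_lt1; exact/phi_itv0/ltW.
- rewrite phi0; apply: cvg_comp cvg_phi0 _.
  by apply: ch; rewrite normr0.
- move=> t t0; have q01 := phi_itv0 t (ltW t0).
  have d := @is_deriveZ _ _ _ _ p`!%:R _ _ _
     (is_derive1_comp (is_derive_Hser R m N k _ N0 k0 q01) (is_derive_phi t t0)).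
  by apply: (is_derive_eq d); rewrite /GRing.scale /= /h /phi; ring.
- rewrite phi0; apply: cvgMl_tmp; apply: cvg_comp cvg_phi0 _.
  have h01 : 0 <= (0 : R) < 1 by rewrite lexx ltr01.
  exact: (is_derive_continuous _ _ _ _ (is_derive_Hser R m N k _ N0 k0 h01)).
- apply: cvgMl_tmp; apply: cvg_comp cvg_phiy _.
  exact: (Hser_cvg _ _ hm _ _ Nn kn N0 k0).
by rewrite phi0 Hser0 mulr0 subr0 mulrA mulVf // mul1r.
Qed.
End Fm.

(** * The identity *)

(** [Ilim_parts] solved for its first integral and used e times; each use changes the sign of what
    remains. *)
Lemma Ilim_chain (R : realType) m (hm : (1 <= m)%N) (a b : seq nat) (c e : nat) :
  all (leq 1) a -> all (leq 1) b -> (1 <= c)%N ->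
  Ilim R m (rcons a c) (rcons b e.+1) =
  \sum_(0 <= i < e) (-1) ^+ i * T m a ((c + i).+1%:R : R) * T m b ((e.+1 - i)%N%:R : R)
  + (-1) ^+ e * Ilim R m (rcons a (c + e)%N) (rcons b 1%N).
Proof.
move=> a0 b0; elim: e c => [|e IH] c c0.
  by rewrite big_geq // add0r expr0 mul1r addn0.
have H := @Ilim_parts R m hm a b c e.+1 a0 b0 c0 isT.
rewrite -[LHS](addrK (Ilim R m (rcons a c.+1) (rcons b e.+1))) H.
rewrite IH // big_nat_recl //.
rewrite expr0 mul1r addn0 subn0 addnS exprS opprD addrA mulN1r mulNr.
congr (_ + _ - _ * _).
rewrite -sumrN; apply: eq_bigr => i _.
by rewrite exprS mulN1r !mulNr subSS addnS addSn.
Qed.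

Lemma kup_recr k n : kup k n.+1 = rcons (kup k n) (k n.+1).
Proof. by rewrite /kup -[in LHS](addn1 n) iotaD map_cat /= cats1. Qed.

Lemma kdown_recr k r n : kdown k r n.+1 = rcons (kdown k r n) (k (r - n)%N).
Proof. by rewrite /kdown -[in LHS](addn1 n) iotaD map_cat /= cats1. Qed.

Section Main.
Variables (R : realType) (m : nat).
Hypothesis hm : (1 <= m)%N.
Variables (p q r : nat) (k : nat -> nat).
Hypothesis (hp : (1 <= p)%N) (hq : (1 <= q)%N) (hr : (1 <= r)%N).
Hypothesis hk : forall i, (1 <= i <= r)%N -> (2 <= k i)%N.

(** Once k_r, ..., k_(r+1-j) have been carried over, [al j] is the word that received them and
    [be j] the part of the other word before k_(r-j). *)
Let al j := nseq p.-1 1%N ++ kdown k r j.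
Let be j := nseq q.-1 1%N ++ kup k (r - j - 1).

Lemma all_al j : (j <= r)%N -> all (leq 1) (al j).
Proof.
move=> jr; rewrite all_cat all_nseq orbT /=; apply/allP => x /mapP[i].
rewrite mem_iota add0n => /andP[_ ij] ->; apply: ltnW; apply: hk; lia.
Qed.

Lemma all_be j : all (leq 1) (be j).
Proof.
rewrite all_cat all_nseq orbT /=; apply/allP => x /mapP[i].
by rewrite mem_iota => /andP[i1 ij] ->; apply: ltnW; apply: hk; lia.
Qed.

Lemma al_rcons j : nseq p.-1 1%N ++ kdown k r j.+1 = rcons (al j) (k (r - j)%N).
Proof. by rewrite kdown_recr rcons_cat. Qed.

Lemma be_rcons j : (j < r.-1)%N -> be j = rcons (be j.+1) (k (r - j.+1)%N).
Proof.
move=> jr; rewrite /be; have -> : (r - j - 1 = (r - j.+1 - 1).+1)%N by lia.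
by rewrite kup_recr rcons_cat; congr (_ ++ rcons _ (k _)); lia.
Qed.

(** The transfer of k_(r-j): [J j] is the integral before it, [E j] the integral after it, and [S j]
    collects the products of T-values left on the way. *)
Let J j := Ilim R m (rcons (al j) 1%N) (rcons (be j) (k (r - j)%N).-1).
Let E j := Ilim R m (rcons (al j) (k (r - j)%N).-1) (rcons (be j) 1%N).
Let S j : R := \sum_(1 <= i < (k (r - j)%N).-1) (-1) ^+ i.-1
         * T m (al j) (i.+1)%:R * T m (be j) (k (r - j)%N - i)%:R.

(** The last entry falls from k_(r-j) - 1 to 1 in k_(r-j) - 2 steps, a number of the same parity as
    k_(r-j). *)
Lemma J_E j : (j < r)%N -> J j = S j + (-1) ^+ k (r - j)%N * E j.
Proof.
move=> jr; have : (2 <= k (r - j))%N by apply: hk; lia.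
rewrite /J /E /S; case: (k _) => [//|[//|e]] _ /=.
rewrite (Ilim_chain R m hm _ _ 1 e (all_al j (ltnW jr)) (all_be j) isT).
rewrite !exprS !mulN1r opprK big_add1 /=.
by congr (_ + _).
Qed.

(** The passage from one transfer to the next. As j < r - 1, [be j] still ends with k_(r-j-1) >= 2,
    and [al j.+1] ends with k_(r-j), so [cvg_Aser_diff] applies to these two entries. *)
Lemma cvg_D j : (j < r.-1)%N ->
  A m (nseq p.-1 1%N ++ kdown k r j.+1) x * A m (be j ++ [:: 1%N]) x
    - A m ((nseq p.-1 1%N ++ kdown k r j.+1) ++ [:: 1%N]) x * A m (be j) x
    @[x --> 1^'-] --> E j - J j.+1.
Proof.
rewrite al_rcons => jr; have jr' : (j <= r)%N by lia.
have k1 : (2 <= k (r - j))%N by apply: hk; lia.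
have k2 : (2 <= k (r - j.+1))%N by apply: hk; lia.
have a0 := all_al j jr'; have b0 := all_be j.+1.
have := @cvg_Aser_diff R m hm (al j) (be j.+1) (k (r - j)%N).-1 (k (r - j.+1)%N).-1 a0 b0.
rewrite !prednK; [|lia|lia] => H; have := H ltac:(lia) ltac:(lia).
have alS : al j.+1 = rcons (al j) (k (r - j)%N) := al_rcons j.
rewrite /E /J alS -be_rcons // => {}H.
apply: cvg_trans H; apply: near_eq_cvg; apply: near_left1 => x x01.
have b0' := all_be j.
rewrite !cats1 !A_Aser ?all_rcons ?a0 ?b0' ?normr_lt1 ?andbT //=; lia.
Qed.

Let K j := sumn (kdown k r j).

(** [J n] becomes [S n] plus a signed [E n], which is split as (E n - J (n+1)) + J (n+1); the signs
    accumulate to the exponents K. *)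
Lemma J0_telescope n : (n <= r.-1)%N ->
  J 0 = \sum_(0 <= j < n) (-1) ^+ K j * S j
    + \sum_(0 <= j < n) (-1) ^+ K j.+1 * (E j - J j.+1) + (-1) ^+ K n * J n.
Proof.
elim: n => [|n IH] nr; first by rewrite !big_geq // !add0r expr0 mul1r.
rewrite IH; last exact: ltnW.
have recr (F : nat -> R) : \sum_(0 <= j < n.+1) F j = \sum_(0 <= j < n) F j + F n.
  by rewrite big_nat_recr.
rewrite !recr; have -> : J n = S n + (-1) ^+ k (r - n)%N * E n by apply: J_E; lia.
have -> : K n.+1 = (K n + k (r - n))%N by rewrite /K kdown_recr sumn_rcons.
rewrite exprD; ring.
Qed.

Lemma K_sum : K r = (\sum_(1 <= i < r.+1) k i)%N.
Proof.
rewrite /K /kdown sumnE big_map big_add1 /= big_nat_rev /= add0n /index_iota subn0.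
rewrite big_seq [RHS]big_seq; apply: eq_bigr => i; rewrite mem_iota => /andP[_ ir].
by congr k; lia.
Qed.

(** The transfer of k_1, at j = r - 1, has no successor: it contributes [S] but no boundary
    limit. *)
Lemma J0_expand :
  J 0 = \sum_(0 <= j < r) (-1) ^+ K j * S j
    + \sum_(0 <= j < r.-1) (-1) ^+ K j.+1 * (E j - J j.+1)
    + (-1) ^+ (\sum_(1 <= i < r.+1) k i)%N * E r.-1.
Proof.
have JE : J r.-1 = S r.-1 + (-1) ^+ k (r - r.-1)%N * E r.-1 by apply: J_E; lia.
rewrite (J0_telescope r.-1 (leqnn _)) JE.
have -> : (\sum_(1 <= i < r.+1) k i = K r.-1 + k (r - r.-1))%N.
  by rewrite -K_sum -{1}(prednK hr) /K kdown_recr sumn_rcons.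
have -> : \sum_(0 <= j < r) (-1) ^+ K j * S j =
    \sum_(0 <= j < r.-1) (-1) ^+ K j * S j + (-1) ^+ K r.-1 * S r.-1.
  by rewrite -{1}(prednK hr) big_nat_recr.
rewrite exprD; ring.
Qed.

Lemma J0_psi f : is_fm m f ->
  psi m f (nseq q.-1 1%N ++ kup k r.-1 ++ [:: (k r).-1]) (p.+1)%:R = J 0.
Proof.
move=> hf; have k1 : (2 <= k r)%N by apply: hk; lia.
have -> : J 0 = Ilim R m (nseq p 1%N)
    (nseq q.-1 1%N ++ kup k r.-1 ++ [:: (k r).-1]).
  rewrite /J /al /be /kdown /= cats0 subn0 subn1 catA cats1 -cats1.
  by rewrite -[p in RHS](prednK hp) -(addn1 p.-1) nseqD.
apply: psi_Ilim => //; first by case: (nseq _ _); case: (kup _ _).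
have b0 := all_be 0; rewrite /be subn0 subn1 in b0.
by rewrite catA all_cat b0 /= andbT; lia.
Qed.

(** After the last transfer, [be r.-1] followed by 1 is a word of q ones; the symmetry [HserC] puts
    it first, as [psi_Ilim] requires. *)
Lemma E_psi f : is_fm m f ->
  psi m f (nseq p.-1 1%N ++ kdown k r r.-1 ++ [:: (k 1%N).-1]) (q.+1)%:R = E r.-1.
Proof.
move=> hf; have k1 : (2 <= k 1)%N by apply: hk; lia.
have -> : E r.-1 = Ilim R m (nseq q 1%N)
    (nseq p.-1 1%N ++ kdown k r r.-1 ++ [:: (k 1%N).-1]).
  have r1 : (r - r.-1 = 1)%N by lia.
  rewrite /E /Ilim HserC /al /be r1 subnn /= cats0.
  by rewrite catA cats1 -[q in RHS](prednK hq) -(addn1 q.-1) nseqD cats1.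
apply: psi_Ilim => //; first by case: (nseq _ _); case: (kdown _ _ _).
have a0 := all_al r.-1 (leq_pred r); rewrite /al in a0.
by rewrite catA all_cat a0 /= andbT; lia.
Qed.
End Main.

Theorem theorem4p9 (R : realType) (m : nat) (hm : (1 <= m)%N)
    (f : R -> R) (hf : is_fm m f)
    (p q r : nat) (hp : (1 <= p)%N) (hq : (1 <= q)%N) (hr : (1 <= r)%N)
    (k : nat -> nat) (hk : forall i, (1 <= i <= r)%N -> (2 <= k i)%N) :
  let K j := sumn (kdown k r j) in
  let a j := nseq p.-1 1%N ++ kdown k r j.+1 in
  let b j := nseq q.-1 1%N ++ kup k (r - j - 1) in
  let D j (x : R) :=
    A m (a j) x * A m (b j ++ [:: 1%N]) x
    - A m (a j ++ [:: 1%N]) x * A m (b j) x in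
  (forall j, (j < r.-1)%N -> cvg (D j x @[x --> 1^'-])) /\
  psi m f (nseq q.-1 1%N ++ kup k r.-1 ++ [:: (k r).-1]) (p.+1)%:R
  - (-1) ^+ (\sum_(1 <= i < r.+1) k i)%N
    * psi m f (nseq p.-1 1%N ++ kdown k r r.-1 ++ [:: (k 1%N).-1]) (q.+1)%:R
  = \sum_(0 <= j < r) (-1) ^+ K j *
      (\sum_(1 <= i < (k (r - j)%N).-1) (-1) ^+ i.-1
         * T m (nseq p.-1 1%N ++ kdown k r j) (i.+1)%:R
         * T m (nseq q.-1 1%N ++ kup k (r - j - 1)) (k (r - j)%N - i)%:R)
  + \sum_(0 <= j < r.-1) (-1) ^+ K j.+1 * lim (D j x @[x --> 1^'-]).
Proof.
move=> K a b D.
have cD j (jr : (j < r.-1)%N) := cvg_D R m hm p q r k hp hq hr hk j jr.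
split=> [j jr|]; first by apply/cvg_ex; eexists; exact: (cD j jr).
rewrite (J0_psi R m hm p q r k hp hq hr hk f hf) (E_psi R m hm p q r k hp hq hr hk f hf).
(* The last term of the expansion is the signed second psi value, which cancels. *)
rewrite (J0_expand R m hm p q r k hp hq hr hk) addrK.
congr (_ + _); rewrite big_nat [RHS]big_nat; apply: eq_bigr => j /andP[_ jr].
by congr (_ * _); apply/esym/cvg_lim => //; exact: (cD j jr).
Qed.
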